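(* Let $\alpha_0>\alpha_1>\alpha_2>\cdots$ be the zeros of the Digamma function $\psi$. Then $$\sum_{k=0}^\infty\frac{1}{\alpha_k^2-1}=\frac{\gamma}{2}+\frac{\pi^2}{12\gamma}-1,$$ where $\gamma$ is the Euler constant.
   Context: $\psi(z)=\Gamma'(z)/\Gamma(z)$, $z\in\mathbb C\setminus\{0,-1,-2,\dots\}$, is the Digamma function, with $\Gamma$ the Euler gamma function. It is known that all zeros of $\psi$ are real and simple, and that all of them except one are negative; $\alpha_k$ denotes the $k$th zero counted from the right, so $\alpha_0=1.461632\dots$ is the unique positive zero. *)

(* Defs.v *)
(* Stdlib reals with Coquelicot. *)
From Stdlib Require Import Reals ZArith.
From Coquelicot Require Import Coquelicot.

Open Scope R_scope.

Definition Cexp (z : C) : C :=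
  (exp (Re z) * cos (Im z), exp (Re z) * sin (Im z)).

(* Principal value of t^z; used for t > 0 only. *)
Definition Rcpow (t : R) (z : C) : C := Cexp (z * RtoC (ln t))%C.

(* Euler's integral of the second kind; convergent for 0 < Re z. *)
Definition Euler_integral (z : C) : C :=
  RInt_gen (V := C_R_CompleteNormedModule)
    (fun t : R => (Rcpow t (z - 1) * RtoC (exp (- t)))%C)
    (at_right 0) (Rbar_locally p_infty).

(* z (z + 1) ... (z + n - 1) *)
Fixpoint rising (z : C) (n : nat) : C :=
  match n with
  | O => 1%C
  | S m => (rising z m * (z + RtoC (INR m)))%C
  end.

(* Least natural number n with 0 < Re z + n; it is 0 when 0 < Re z. *)
Definition shift (z : C) : nat := Z.to_nat (up (- Re z)).

(* Euler's integral on the right half-plane, continued to the left by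
   Gamma z = Gamma (z + n) / (z (z + 1) ... (z + n - 1)).  The values at
   0, -1, -2, ... are junk. *)
Definition Gamma (z : C) : C :=
  (Euler_integral (z + RtoC (INR (shift z))) / rising z (shift z))%C.

Definition digamma_domain (z : C) : Prop :=
  forall n : nat, z <> RtoC (- INR n).

(* Coquelicot's [C_derive] takes the limit of the difference quotient along
   the horizontal direction; on [digamma_domain], where Gamma is holomorphic,
   this is the complex derivative. *)
Definition digamma (z : C) : C := (C_derive Gamma z / Gamma z)%C.

Definition digamma_zero (z : C) : Prop :=
  digamma_domain z /\ digamma z = 0%C.

(* lim (1 + 1/2 + ... + 1/(n+1) - ln (n+1)); [sum_f_R0 f n] has n+1 terms. *)
Definition Euler_gamma : R :=
  real (Lim_seq (fun n : nat =>
    sum_f_R0 (fun k : nat => / INR (S k)) n - ln (INR (S n)))).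

(* Main.v *)
Require Import Defs.
From Stdlib Require Import Reals Lra Lia Znat Factorial Ranalysis5 Classical_Prop ClassicalEpsilon.
From Coquelicot Require Import Coquelicot.
Open Scope R_scope.

(** On the real line psi(x) = lim (ln n - sum_{k<n} 1/(x+k)), and each of these
    rational functions has exactly one zero a_{n,k} in every component of
    R \ {0, -1, -2, ...} whose left endpoint is one of its poles (and no other
    zero, by degree).  Its numerator therefore equals
    ln n * prod_k (x - a_{n,k}), and 1/(a^2-1) = (1/(-1-a) - 1/(1-a))/2 turns
    sum_k 1/(a_{n,k}^2-1) into the difference of the logarithmic derivatives of
    the numerator at -1 and 1, which are explicit in harmonic numbers.  Since
    a_{n,k} -> alpha_k and -k < a_{n,k} < 1-k for k >= 1, dominated convergence
    gives the sum over the alpha_k.  That Gamma'/Gamma is this limit on the real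
    line follows from the functional equation and the log-convexity of Gamma, as
    in the Bohr-Mollerup theorem; as all zeros are real by assumption, no complex
    analysis is needed. *)

(** * Finite sums, Tannery's theorem and the Basel problem *)

(** The rational approximations stand in for a Hadamard factorisation of psi: for a polynomial,
    counting degrees identifies the product over the zeros. The points 1 and -1 behave differently.
    The point 1 is regular, and the logarithmic derivative of the numerator there is H_n + S_n / (ln
    n - H_n), where S_n is the sum of 1/k^2 for k <= n. Since ln n - H_n tends to -gamma, the Basel
    sum enters divided by gamma, which is the origin of pi^2 / (12 gamma). The point -1 is a pole,
    where the numerator reduces to the single product (n-2)!, with logarithmic derivative 2 H_(n-2)
    - ln n - 2. In half the difference the divergent parts combine to 2 H_(n-2) - H_n - ln n, which
    tends to gamma, and gamma / 2 - 1 results. The hypotheses only say that the zeros are listed in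
    decreasing order; that alpha_k lies in the component starting at -k has to be deduced from the
    existence and uniqueness of a zero in each component. *)

Fixpoint psum (f : nat -> R) (n : nat) : R :=
  match n with
  | O => 0
  | S m => psum f m + f m
  end.

Lemma psum_ext (f g : nat -> R) n :
  (forall k, (k < n)%nat -> f k = g k) -> psum f n = psum g n.
Proof.
  induction n as [|n IH]; intros H; simpl; [reflexivity|].
  rewrite IH by (intros; apply H; lia). rewrite H by lia. reflexivity.
Qed.

Lemma psum_le (f g : nat -> R) n :
  (forall k, (k < n)%nat -> f k <= g k) -> psum f n <= psum g n.
Proof.
  induction n as [|n IH]; intros H; simpl; [lra|].
  apply Rplus_le_compat; [apply IH; intros|]; apply H; lia.
Qed.

Lemma psum_plus (f g : nat -> R) n :
  psum (fun k => f k + g k) n = psum f n + psum g n.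
Proof. induction n as [|n IH]; simpl; [|rewrite IH]; ring. Qed.

Lemma psum_scal (c : R) (f : nat -> R) n :
  psum (fun k => c * f k) n = c * psum f n.
Proof. induction n as [|n IH]; simpl; [|rewrite IH]; ring. Qed.

Lemma psum_const (c : R) n : psum (fun _ => c) n = INR n * c.
Proof.
  induction n as [|n IH]; [simpl; ring|].
  rewrite S_INR; simpl; rewrite IH; ring.
Qed.

Lemma psum_add (f : nat -> R) m n :
  psum f (m + n) = psum f m + psum (fun k => f (m + k)%nat) n.
Proof.
  induction n as [|n IH]; [rewrite Nat.add_0_r; simpl; ring|].
  rewrite Nat.add_succ_r; simpl; rewrite IH; ring.
Qed.

Lemma psum_head (f : nat -> R) n :
  psum f (S n) = f O + psum (fun k => f (S k)) n.
Proof.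
  change (S n) with (1 + n)%nat. rewrite psum_add. simpl. ring.
Qed.

Lemma psum_rev (f : nat -> R) n :
  psum f n = psum (fun k => f (n - 1 - k)%nat) n.
Proof.
  induction n as [|n IH]; [reflexivity|].
  rewrite (psum_head (fun k => f (S n - 1 - k)%nat)). replace (S n - 1 - 0)%nat with n by lia.
  transitivity (f n + psum f n); [simpl; ring|]. rewrite IH. f_equal.
  apply psum_ext; intros k Hk; f_equal; lia.
Qed.

Lemma sum_n_psum (f : nat -> R) n : sum_n f n = psum f (S n).
Proof.
  induction n as [|n IH].
  - rewrite sum_O; simpl; ring.
  - rewrite sum_Sn, IH; reflexivity.
Qed.

Lemma is_series_psum (f : nat -> R) (l : R) :
  is_series f l <-> is_lim_seq (psum f) l.
Proof.
  split; intros H.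
  - apply is_lim_seq_incr_1.
    apply is_lim_seq_ext with (sum_n f); [intros n; apply sum_n_psum|exact H].
  - apply is_lim_seq_incr_1 in H.
    apply (is_lim_seq_ext _ (sum_n f)) in H; [exact H|].
    intros n; symmetry; apply sum_n_psum.
Qed.

Lemma is_lim_seq_R (u : nat -> R) (l : R) :
  is_lim_seq u l <->
  forall eps, 0 < eps -> exists N, forall n, (N <= n)%nat -> Rabs (u n - l) < eps.
Proof.
  rewrite <- is_lim_seq_spec. split; intros H.
  - intros eps He. exact (H (mkposreal eps He)).
  - intros [eps He]. exact (H eps He).
Qed.

(* Tannery's theorem with a telescoping dominating sequence, in the direction
   where the limit of the full sums is known. *)
Lemma tannery (u : nat -> nat -> R) (v T : nat -> R) (K : nat) (l : R) :
  (forall k, is_lim_seq (fun n => u n k) (v k)) ->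
  (forall n k, (K <= k < n)%nat -> Rabs (u n k) <= T k - T (S k)) ->
  (forall k, (K <= k)%nat -> 0 <= T k) ->
  is_lim_seq T 0 ->
  is_lim_seq (fun n => psum (u n) n) l ->
  is_series v l.
Proof.
  intros Hu HT Tpos T0 Hl.
  apply is_series_psum.
  assert (Htail : forall n m, (K <= m <= n)%nat ->
    Rabs (psum (u n) n - psum (u n) m) <= T m - T n).
  { intros n m Hm. replace n with (m + (n - m))%nat at 2 by lia.
    rewrite psum_add.
    replace (_ + _ - _) with (psum (fun k => u n (m + k)%nat) (n - m)) by ring.
    assert (Hj : forall j, (j <= n - m)%nat ->
      Rabs (psum (fun k => u n (m + k)%nat) j) <= T m - T (m + j)%nat).
    { induction j as [|j IH]; intros Hj.
      - simpl. rewrite Rabs_R0, Nat.add_0_r. lra.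
      - simpl. eapply Rle_trans; [apply Rabs_triang|].
        rewrite Nat.add_succ_r.
        specialize (IH ltac:(lia)). specialize (HT n (m + j)%nat ltac:(lia)). lra. }
    specialize (Hj (n - m)%nat (Nat.le_refl _)).
    replace (m + (n - m))%nat with n in Hj by lia. exact Hj. }
  assert (Hm : forall m, is_lim_seq (fun n => psum (u n) m) (psum v m)).
  { induction m as [|m IH]; simpl; [apply is_lim_seq_const|].
    apply is_lim_seq_plus'; [exact IH | apply Hu]. }
  apply is_lim_seq_R. intros eps He.
  destruct (proj1 (is_lim_seq_R _ _) T0 eps He) as [N HN].
  exists (Nat.max N K). intros m Hmm.
  (* With [m] fixed and [n] tending to infinity, the tail bound [T m - T n <= T m] controls the
     distance from [l] to the partial sum of [v]. Convergence of that series is thus a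
     conclusion. *)
  assert (Hle : Rbar_le (Rabs (l - psum v m)) (T m)).
  { apply (is_lim_seq_le_loc (fun n => Rabs (psum (u n) n - psum (u n) m)) (fun _ => T m)).
    - exists m. intros n Hn. eapply Rle_trans; [apply Htail; lia|].
      specialize (Tpos n ltac:(lia)). lra.
    - apply (is_lim_seq_abs _ (Finite (l - psum v m))).
      apply is_lim_seq_minus'; [exact Hl | apply Hm].
    - apply is_lim_seq_const. }
  simpl in Hle. rewrite Rabs_minus_sym.
  specialize (HN m ltac:(lia)). rewrite Rminus_0_r in HN.
  pose proof (Rle_abs (T m)). lra.
Qed.

(** * The Basel problem through sums of inverse squared sines *)

Definition csc2 (N : R) (k : nat) : R := / (sin ((INR k + 1) * PI / N)) ^ 2.

Lemma csc2_double (y : R) :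
  sin y <> 0 -> cos y <> 0 -> / sin y ^ 2 + / cos y ^ 2 = 4 * / sin (2 * y) ^ 2.
Proof.
  intros Hs Hc. rewrite sin_2a. pose proof (sin2_cos2 y) as H. unfold Rsqr in H.
  transitivity ((sin y * sin y + cos y * cos y) * / (sin y ^ 2 * cos y ^ 2)).
  - field; auto.
  - rewrite H. field; auto.
Qed.

(** With M = m + 1, the terms at y and y + pi/2 add up to four times the term at 2y, and the
    unpaired middle angle pi/2 contributes 1. The reflection y -> pi - y makes the two halves around
    the middle equal. The half sum is the one used for [Basel], because its angles lie in (0, pi/2),
    where [csc2_bounds] applies. *)
Lemma sum_csc2_step (m : nat) :
  psum (csc2 (2 * INR (S m))) (m + S m) = 4 * psum (csc2 (INR (S m))) m + 1 /\
  psum (csc2 (2 * INR (S m))) m = 2 * psum (csc2 (INR (S m))) m.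
Proof.
  set (M := INR (S m)).
  assert (HM : 0 < M) by (apply lt_0_INR; lia).
  assert (HP := PI_RGT_0).
  assert (Hmid : csc2 (2 * M) m = 1).
  { unfold csc2. rewrite <- S_INR. fold M.
    replace (M * PI / (2 * M)) with (PI / 2) by (field; lra).
    rewrite sin_PI2. field. }
  assert (Hpair : forall k, (k < m)%nat ->
    csc2 (2 * M) k + csc2 (2 * M) (m + S k) = 4 * csc2 M k).
  { intros k Hk. unfold csc2.
    set (y := (INR k + 1) * PI / (2 * M)).
    assert (Hk1 : INR k + 1 < M).
    { unfold M. rewrite <- S_INR. apply lt_INR; lia. }
    assert (Hk0 := pos_INR k).
    assert (Hy : 0 < y < PI / 2).
    { unfold y; split.
      - apply Rdiv_lt_0_compat; [apply Rmult_lt_0_compat|]; lra.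
      - apply Rmult_lt_reg_r with (2 * M); [lra|].
        unfold Rdiv. rewrite Rmult_assoc, Rinv_l by lra. nra. }
    replace ((INR (m + S k) + 1) * PI / (2 * M)) with (PI / 2 + y).
    2:{ unfold y. rewrite plus_INR.
        replace (INR m) with (M - 1) by (unfold M; rewrite S_INR; ring).
        rewrite S_INR. field. lra. }
    rewrite <- cos_sin.
    replace ((INR k + 1) * PI / M) with (2 * y) by (unfold y; field; lra).
    apply csc2_double; apply Rgt_not_eq; [apply sin_gt_0 | apply cos_gt_0]; lra. }
  assert (Hrefl : psum (fun k => csc2 (2 * M) (m + S k)) m = psum (csc2 (2 * M)) m).
  { rewrite psum_rev. apply psum_ext. intros k Hk. unfold csc2.
    replace ((INR (m + S (m - 1 - k)) + 1) * PI / (2 * M))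
      with (PI - (INR k + 1) * PI / (2 * M)).
    - rewrite sin_PI_x. reflexivity.
    - replace (m + S (m - 1 - k))%nat with (m + (m - k))%nat by lia.
      rewrite plus_INR, minus_INR by lia.
      replace (INR m) with (M - 1) by (unfold M; rewrite S_INR; ring).
      field. lra. }
  assert (Hsum : psum (csc2 (2 * M)) m + psum (fun k => csc2 (2 * M) (m + S k)) m
                 = 4 * psum (csc2 M) m).
  { rewrite <- psum_plus, <- psum_scal. apply psum_ext. exact Hpair. }
  split.
  - rewrite psum_add, psum_head, Nat.add_0_r, Hmid. lra.
  - lra.
Qed.

(** The value (N^2 - 1) / 3 survives doubling, as 4 (N^2 - 1) / 3 + 1 = ((2N)^2 - 1) / 3, and starts
    from the empty sum at N = 1. Powers of two are enough because the partial sums in [Basel] are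
    monotone. *)
Lemma sum_csc2_pow2 (n : nat) : exists m,
  S m = (2 ^ n)%nat /\ psum (csc2 (INR (S m))) m = (INR (S m) ^ 2 - 1) / 3.
Proof.
  induction n as [|n [m [Hm IH]]].
  - exists O. split; [reflexivity | simpl; field].
  - exists (m + S m)%nat. split; [simpl; lia|].
    replace (INR (S (m + S m))) with (2 * INR (S m)).
    + rewrite (proj1 (sum_csc2_step m)), IH. field.
    + replace (S (m + S m)) with (2 * S m)%nat by lia. rewrite mult_INR. reflexivity.
Qed.

Lemma x_cos_lt_sin (x : R) : 0 < x < PI / 2 -> x * cos x < sin x.
Proof.
  intros Hx. assert (HP := PI_RGT_0).
  destruct (MVT_cor2 (fun t => sin t - t * cos t) (fun t => t * sin t) 0 x)
    as [c [E Hc]]; [lra | |].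
  - intros t _. apply is_derive_Reals. auto_derive; [exact I | ring].
  - rewrite sin_0 in E. assert (0 < sin c) by (apply sin_gt_0; lra).
    assert (0 < c * sin c) by (apply Rmult_lt_0_compat; lra). nra.
Qed.

(** This is sin x < x < tan x, inverted and squared; the left side is cot^2 x. *)
Lemma csc2_bounds (x : R) :
  0 < x < PI / 2 -> / sin x ^ 2 - 1 <= / x ^ 2 <= / sin x ^ 2.
Proof.
  intros Hx. assert (HP := PI_RGT_0).
  assert (Hs : 0 < sin x) by (apply sin_gt_0; lra).
  assert (Hc : 0 < cos x) by (apply cos_gt_0; lra).
  assert (Hsx := sin_lt_x x (proj1 Hx)).
  assert (Hxc := x_cos_lt_sin x Hx).
  split.
  - pose proof (sin2_cos2 x) as E. unfold Rsqr in E.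
    replace (/ sin x ^ 2 - 1) with (cos x ^ 2 * / sin x ^ 2).
    2:{ replace (cos x ^ 2) with (1 - sin x ^ 2) by nra. field. lra. }
    apply Rmult_le_reg_r with (x ^ 2 * sin x ^ 2); [apply Rmult_lt_0_compat; nra|].
    replace (cos x ^ 2 * / sin x ^ 2 * (x ^ 2 * sin x ^ 2)) with ((x * cos x) ^ 2)
      by (field; lra).
    replace (/ x ^ 2 * (x ^ 2 * sin x ^ 2)) with (sin x ^ 2) by (field; lra).
    apply pow_incr. split; [nra | lra].
  - apply Rinv_le_contravar; [nra|]. apply pow_incr; lra.
Qed.

Lemma psum_mono (f : nat -> R) m n :
  (forall k, 0 <= f k) -> (m <= n)%nat -> psum f m <= psum f n.
Proof.
  intros Hf Hmn. replace n with (m + (n - m))%nat by lia. rewrite psum_add.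
  assert (H := psum_le (fun _ => 0) (fun k => f (m + k)%nat) (n - m) (fun k _ => Hf _)).
  rewrite psum_const in H. lra.
Qed.

Lemma Basel : is_lim_seq (psum (fun k => / (INR k + 1) ^ 2)) (PI ^ 2 / 6).
Proof.
  set (f := fun k => / (INR k + 1) ^ 2).
  assert (HP := PI_RGT_0).
  assert (HP4 := PI_4).
  assert (fpos : forall k, 0 <= f k).
  { intros k. unfold f. assert (Hk := pos_INR k).
    apply Rlt_le, Rinv_0_lt_compat. nra. }
  (* Rescaling the half sum for M = 2^n by pi^2 / (4 M^2) leaves an error of at most (pi^2 / 4) / M;
     with pi <= 4 the constant 8 is generous. *)
  assert (Hsq : forall n, exists m, S m = (2 ^ n)%nat /\
    PI ^ 2 / 6 - 8 / INR (S m) <= psum f m <= PI ^ 2 / 6).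
  { intros n. destruct (sum_csc2_pow2 n) as [m [Hm HA]].
    exists m. split; [exact Hm|].
    destruct (sum_csc2_step m) as [_ HB]. rewrite HA in HB.
    set (M := INR (S m)) in *.
    assert (HM : 1 <= M) by (apply (le_INR 1); lia).
    assert (Hk : forall k, (k < m)%nat ->
      csc2 (2 * M) k - 1 <= 4 * M ^ 2 / PI ^ 2 * f k <= csc2 (2 * M) k).
    { intros k Hk. unfold csc2, f.
      set (y := (INR k + 1) * PI / (2 * M)).
      assert (Hk1 : INR k + 1 < M).
      { unfold M. rewrite <- S_INR. apply lt_INR; lia. }
      assert (Hk0 := pos_INR k).
      assert (Hy : 0 < y < PI / 2).
      { unfold y; split.
        - apply Rdiv_lt_0_compat; [apply Rmult_lt_0_compat|]; lra.
        - apply Rmult_lt_reg_r with (2 * M); [lra|].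
          unfold Rdiv. rewrite Rmult_assoc, Rinv_l by lra. nra. }
      replace (4 * M ^ 2 / PI ^ 2 * / (INR k + 1) ^ 2) with (/ y ^ 2)
        by (unfold y; field; lra).
      apply csc2_bounds; exact Hy. }
    assert (Hlo : psum (csc2 (2 * M)) m - INR m <= 4 * M ^ 2 / PI ^ 2 * psum f m).
    { rewrite <- psum_scal.
      replace (psum (csc2 (2 * M)) m - INR m)
        with (psum (fun k => csc2 (2 * M) k + -1) m) by (rewrite psum_plus, psum_const; ring).
      apply psum_le. intros k Hkm. apply (Hk k Hkm). }
    assert (Hhi : 4 * M ^ 2 / PI ^ 2 * psum f m <= psum (csc2 (2 * M)) m).
    { rewrite <- psum_scal. apply psum_le. intros k Hkm. apply (Hk k Hkm). }
    rewrite HB in Hlo, Hhi.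
    replace (INR m) with (M - 1) in Hlo by (unfold M; rewrite S_INR; ring).
    set (h := psum f m) in *.
    set (d := PI ^ 2 / (4 * M ^ 2)).
    assert (Hd : 0 < d) by (apply Rdiv_lt_0_compat; nra).
    assert (Ed : d * (4 * M ^ 2 / PI ^ 2 * h) = h) by (unfold d; field; lra).
    apply Rmult_le_compat_l with (r := d) in Hlo; [|lra].
    apply Rmult_le_compat_l with (r := d) in Hhi; [|lra].
    rewrite Ed in Hlo, Hhi.
    assert (E1 : d * (2 * ((M ^ 2 - 1) / 3)) = PI ^ 2 / 6 - d * (2 / 3))
      by (unfold d; field; lra).
    assert (E2 : d * M = PI ^ 2 / 4 * / M) by (unfold d; field; lra).
    assert (HiM : 0 < / M) by (apply Rinv_0_lt_compat; lra).
    split; [|lra].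
    replace (d * (2 * ((M ^ 2 - 1) / 3) - (M - 1)))
      with (PI ^ 2 / 6 - d * (2 / 3) - d * M + d) in Hlo by (rewrite <- E1; ring).
    assert (E4 : PI ^ 2 / 4 * / M <= 8 * / M) by (apply Rmult_le_compat_r; nra).
    unfold Rdiv at 2. lra. }
  apply is_lim_seq_R. intros eps He.
  destruct (nfloor_ex (8 / eps)) as [N HN]; [apply Rlt_le, Rdiv_lt_0_compat; lra|].
  destruct (Hsq (S N)) as [m [Hm Hb]].
  exists m. intros n Hn.
  assert (Hup : psum f n <= PI ^ 2 / 6).
  { destruct (Hsq (S n)) as [m' [Hm' Hb']].
    pose proof (Nat.pow_gt_lin_r 2 (S n) ltac:(lia)).
    pose proof (psum_mono f n m' fpos ltac:(lia)). lra. }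
  pose proof (psum_mono f m n fpos Hn) as Hmn.
  assert (HNm : (S N < S m)%nat)
    by (rewrite Hm; apply Nat.pow_gt_lin_r; lia).
  apply lt_INR in HNm. rewrite (S_INR N) in HNm.
  assert (8 / INR (S m) < eps).
  { apply Rmult_lt_reg_r with (INR (S m)); [pose proof (pos_INR N); lra|].
    unfold Rdiv. rewrite Rmult_assoc, Rinv_l by (pose proof (pos_INR N); lra).
    assert (8 / eps * eps < INR (S m) * eps) by (apply Rmult_lt_compat_r; lra).
    unfold Rdiv in H. rewrite Rmult_assoc, Rinv_l in H by lra. lra. }
  apply Rabs_def1; lra.
Qed.

(** * The function psi on the real line *)

Lemma ln_le_minus_1 (x : R) : 0 < x -> ln x <= x - 1.
Proof.
  intros Hx. pose proof (exp_ineq1_le (ln x)) as H. rewrite exp_ln in H; lra.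
Qed.

Lemma ln_diff_bounds (x y : R) :
  0 < x -> 0 < y -> (y - x) / y <= ln y - ln x <= (y - x) / x.
Proof.
  intros Hx Hy. split.
  - pose proof (ln_le_minus_1 (x / y) (Rdiv_lt_0_compat _ _ Hx Hy)) as H.
    rewrite ln_div in H by assumption.
    replace ((y - x) / y) with (1 - x / y) by (field; lra). lra.
  - pose proof (ln_le_minus_1 (y / x) (Rdiv_lt_0_compat _ _ Hy Hx)) as H.
    rewrite ln_div in H by assumption.
    replace ((y - x) / x) with (y / x - 1) by (field; lra). lra.
Qed.

Lemma is_lim_seq_shifted_INR (a : R) : is_lim_seq (fun n => a + INR n) p_infty.
Proof.
  eapply is_lim_seq_plus; [apply is_lim_seq_const | apply is_lim_seq_INR | reflexivity].
Qed.

Lemma is_lim_seq_div_INR (c a : R) : is_lim_seq (fun n => c / (a + INR n)) 0.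
Proof.
  replace (Finite 0) with (Rbar_mult c 0) by (simpl; f_equal; ring).
  apply is_lim_seq_scal_l.
  replace (Finite 0) with (Rbar_inv p_infty) by reflexivity.
  apply is_lim_seq_inv; [apply is_lim_seq_shifted_INR | discriminate].
Qed.

Lemma INR_large (a : R) : exists N, forall n, (N <= n)%nat -> a < INR n.
Proof.
  destruct (INR_unbounded a) as [N HN]. exists N. intros n Hn.
  apply le_INR in Hn. lra.
Qed.

Lemma ln_shift_lim (a : R) : is_lim_seq (fun n => ln (a + INR n) - ln (INR n)) 0.
Proof.
  apply is_lim_seq_le_le_loc with
    (fun n => a / (a + INR n)) (fun n => a / (0 + INR n)).
  2, 3: apply is_lim_seq_div_INR.
  destruct (INR_large (Rmax 0 (- a))) as [N HN]. exists N. intros n Hn.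
  specialize (HN n Hn).
  pose proof (Rmax_l 0 (- a)). pose proof (Rmax_r 0 (- a)).
  pose proof (ln_diff_bounds (INR n) (a + INR n) ltac:(lra) ltac:(lra)) as Hb.
  replace (a + INR n - INR n) with a in Hb by ring.
  rewrite Rplus_0_l. exact Hb.
Qed.

(** * Euler's constant and the series for psi *)

Definition harmonic (n : nat) : R := psum (fun k => / (INR k + 1)) n.

Lemma harmonic_S (n : nat) : harmonic (S n) = harmonic n + / INR (S n).
Proof. rewrite S_INR. reflexivity. Qed.

(** [g] decreases and [w] increases below it. The bounds come from [w 0] = 1 - ln 2 and [g 1] = 3/2
    - ln 2. The earlier term [g 0] = 1 would not give the strict inequality gamma < 1, on which the
    positivity of [psi 2] rests. *)
Lemma Euler_gamma_lim :
  is_lim_seq (fun n => harmonic n - ln (INR n)) Euler_gamma /\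
  0 < Euler_gamma < 1.
Proof.
  set (g := fun n => harmonic (S n) - ln (INR (S n))).
  set (w := fun n => harmonic (S n) - ln (INR (S (S n)))).
  assert (Hpos : forall n, 0 < INR (S n)) by (intros; apply lt_0_INR; lia).
  assert (gdec : forall n, g (S n) <= g n).
  { intros n. unfold g. rewrite (harmonic_S (S n)).
    pose proof (proj1 (ln_diff_bounds _ _ (Hpos n) (Hpos (S n)))) as H.
    assert (E : INR (S (S n)) - INR (S n) = 1) by (rewrite (S_INR (S n)); ring).
    rewrite E in H. lra. }
  assert (winc : forall n, w n <= w (S n)).
  { intros n. unfold w. rewrite (harmonic_S (S n)).
    pose proof (proj2 (ln_diff_bounds _ _ (Hpos (S n)) (Hpos (S (S n))))) as H.
    assert (E : INR (S (S (S n))) - INR (S (S n)) = 1) by (rewrite (S_INR (S (S n))); ring).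
    rewrite E in H. lra. }
  assert (wg : forall n, w n <= g n).
  { intros n. unfold w, g.
    assert (ln (INR (S n)) <= ln (INR (S (S n)))).
    { apply ln_le; [apply Hpos | apply le_INR; lia]. }
    lra. }
  assert (w0 : w O = 1 - ln 2).
  { unfold w, harmonic. simpl. replace (1 + 1) with 2 by ring. field. }
  assert (g1 : g 1%nat = 3 / 2 - ln 2).
  { unfold g, harmonic. simpl. replace (1 + 1) with 2 by ring. field. }
  assert (ln2lt : ln 2 < 1).
  { rewrite <- (ln_exp 1). apply ln_increasing; [lra|].
    pose proof (exp_ineq1 1 ltac:(lra)). lra. }
  pose proof ln_lt_2 as ln2gt.
  assert (wlow : forall n, 1 - ln 2 <= w n).
  { induction n as [|n IH]; [lra|]. specialize (winc n). lra. }
  assert (glow : forall n, 1 - ln 2 <= g n).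
  { intros n. specialize (wlow n). specialize (wg n). lra. }
  destruct (ex_finite_lim_seq_decr g (1 - ln 2) gdec glow) as [l Hl].
  assert (El : Euler_gamma = l).
  { unfold Euler_gamma.
    rewrite (Lim_seq_ext _ g).
    - rewrite (is_lim_seq_unique _ _ Hl). reflexivity.
    - intros n. unfold g, harmonic. f_equal.
      rewrite <- sum_n_psum, sum_n_Reals. apply sum_eq. intros i _.
      rewrite S_INR. reflexivity. }
  rewrite El. split.
  - apply is_lim_seq_incr_1. exact Hl.
  - assert (gup : forall n, g (S n) <= 3 / 2 - ln 2).
    { induction n as [|n IH]; [lra|]. specialize (gdec (S n)). lra. }
    apply is_lim_seq_incr_1 in Hl.
    assert (H1 : Rbar_le l (3 / 2 - ln 2)).
    { eapply is_lim_seq_le; [exact gup | exact Hl | apply is_lim_seq_const]. }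
    assert (H2 : Rbar_le (1 - ln 2) l).
    { eapply is_lim_seq_le; [intros n; apply (glow (S n)) | apply is_lim_seq_const | exact Hl]. }
    simpl in H1, H2. lra.
Qed.

Lemma ex_series_dominated (a : nat -> R) (C : R) (N : nat) :
  (forall k, (N <= k)%nat -> Rabs (a k) <= C * / (INR k + 1) ^ 2) -> ex_series a.
Proof.
  intros Ha. apply (ex_series_incr_n a N).
  apply (ex_series_le (K := R_AbsRing) (V := R_CompleteNormedModule) _
    (fun k => C * / (INR (N + k) + 1) ^ 2)).
  - intros k. apply Ha. lia.
  - apply (ex_series_scal_l C (fun k => / (INR (N + k) + 1) ^ 2)).
    apply (ex_series_incr_n (fun k => / (INR k + 1) ^ 2) N).
    eexists. apply is_series_psum, Basel.
Qed.

Lemma half_le_shift (x : R) :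
  exists N, forall k, (N <= k)%nat -> (INR k + 1) / 2 <= x + INR k.
Proof.
  destruct (INR_large (1 - 2 * x)) as [N HN]. exists N. intros k Hk.
  specialize (HN k Hk). lra.
Qed.

(** The terms are (x - 1) / ((k + 1)(x + k)), of size at most 2 |x - 1| / (k + 1)^2 once x + k >= (k
    + 1) / 2. Only the tail is estimated, so poles need no exception. *)
Lemma ex_series_psi (x : R) : ex_series (fun k => / (INR k + 1) - / (x + INR k)).
Proof.
  destruct (half_le_shift x) as [N HN].
  apply ex_series_dominated with (2 * Rabs (x - 1)) N. intros k Hk.
  specialize (HN k Hk). pose proof (pos_INR k).
  replace (/ (INR k + 1) - / (x + INR k))
    with ((x - 1) * (/ (INR k + 1) * / (x + INR k))) by (field; lra).
  rewrite Rabs_mult.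
  assert (Hi : 0 < / (INR k + 1) * / (x + INR k)).
  { apply Rmult_lt_0_compat; apply Rinv_0_lt_compat; lra. }
  rewrite (Rabs_pos_eq (_ * _)) by lra.
  replace (2 * Rabs (x - 1) * / (INR k + 1) ^ 2)
    with (Rabs (x - 1) * (/ (INR k + 1) * / ((INR k + 1) / 2))) by (field; lra).
  apply Rmult_le_compat_l; [apply Rabs_pos|].
  apply Rmult_le_compat_l; [apply Rlt_le, Rinv_0_lt_compat; lra|].
  apply Rinv_le_contravar; lra.
Qed.

Lemma ex_series_inv_sqr (x : R) : ex_series (fun k => / (x + INR k) ^ 2).
Proof.
  destruct (half_le_shift x) as [N HN].
  apply ex_series_dominated with 4 N. intros k Hk.
  specialize (HN k Hk). pose proof (pos_INR k).
  rewrite Rabs_pos_eq.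
  - replace (4 * / (INR k + 1) ^ 2) with (/ ((INR k + 1) / 2) ^ 2) by (field; lra).
    apply Rinv_le_contravar; [apply pow_lt; lra | apply pow_incr; lra].
  - apply Rlt_le, Rinv_0_lt_compat, pow_lt. lra.
Qed.

(** The constant is a parameter because it takes several values: ln n for the approximations, a
    shifted value of [psi] in the recurrence, and 1 or -1 when the sign of [psi] is read off near a
    pole. *)
Definition pole_sum (c : R) (n : nat) (x : R) : R :=
  c - psum (fun k => / (x + INR k)) n.

Definition psi (x : R) : R :=
  - Euler_gamma + Series (fun k => / (INR k + 1) - / (x + INR k)).

Lemma psi_lim (x : R) : is_lim_seq (fun n => pole_sum (ln (INR n)) n x) (psi x).
Proof.
  pose proof (Series_correct _ (ex_series_psi x)) as Hs.
  apply is_series_psum in Hs.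
  pose proof (proj1 Euler_gamma_lim) as Hg.
  apply is_lim_seq_opp in Hg.
  apply (is_lim_seq_ext (fun n => - (harmonic n - ln (INR n)) +
     psum (fun k => / (INR k + 1) - / (x + INR k)) n)).
  - intros n. unfold pole_sum, harmonic.
    replace (psum (fun k => / (INR k + 1) - / (x + INR k)) n)
      with (psum (fun k => / (INR k + 1) + -1 * / (x + INR k)) n).
    + rewrite psum_plus, (psum_scal (-1)). ring.
    + apply psum_ext. intros; ring.
  - apply is_lim_seq_plus'; [exact Hg | exact Hs].
Qed.

Lemma pole_sum_shift (c x : R) (m n : nat) :
  pole_sum (pole_sum c n (x + INR m)) m x = pole_sum c (m + n) x.
Proof.
  unfold pole_sum. rewrite psum_add.
  rewrite (psum_ext (fun k => / (x + INR m + INR k)) (fun k => / (x + INR (m + k)))).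
  - ring.
  - intros k _. rewrite plus_INR. f_equal. ring.
Qed.

(** The approximations of order n + m at x and of order n at x + m differ only by ln (n + m) - ln n,
    which vanishes in the limit. This is psi(x) = psi(x + 1) - 1/x iterated; it carries bounds on
    (1, 2) into every component. *)
Lemma psi_shift (x : R) (m : nat) : psi x = pole_sum (psi (x + INR m)) m x.
Proof.
  pose proof (psi_lim x) as H1.
  apply (is_lim_seq_incr_n _ m) in H1.
  assert (H2 : is_lim_seq (fun n => pole_sum (ln (INR (n + m))) (n + m) x)
                 (pole_sum (psi (x + INR m)) m x)).
  { apply (is_lim_seq_ext (fun n => pole_sum (pole_sum (ln (INR n)) n (x + INR m)) m x
       + (ln (INR m + INR n) - ln (INR n)))).
    - intros n. rewrite pole_sum_shift. rewrite (Nat.add_comm n m), plus_INR.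
      unfold pole_sum. ring.
    - replace (Finite (pole_sum (psi (x + INR m)) m x))
        with (Finite (pole_sum (psi (x + INR m)) m x + 0)) by (f_equal; ring).
      apply is_lim_seq_plus'; [|apply ln_shift_lim].
      apply is_lim_seq_minus'; [apply psi_lim | apply is_lim_seq_const]. }
  apply is_lim_seq_unique in H1, H2. rewrite H1 in H2. injection H2. trivial.
Qed.

Lemma psi_1 : psi 1 = - Euler_gamma.
Proof.
  unfold psi. rewrite (Series_ext _ (fun _ => 0 * 0)).
  - rewrite Series_scal_l. ring.
  - intros k. rewrite (Rplus_comm (INR k)). ring.
Qed.

Lemma psi_2 : psi 2 = 1 - Euler_gamma.
Proof.
  pose proof (psi_shift 1 1) as H. rewrite psi_1 in H.
  unfold pole_sum in H. simpl in H. replace (1 + 1) with 2 in H by ring.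
  rewrite Rplus_0_r, Rinv_1 in H. lra.
Qed.

(* The component of R \ {0, -1, -2, ...} whose left endpoint is the pole -j. *)
Definition between_poles (j : nat) (x : R) : Prop :=
  - INR j < x /\ (j = O \/ x < 1 - INR j).

Lemma between_poles_sign (j k : nat) (x : R) :
  between_poles j x -> ((j <= k)%nat /\ 0 < x + INR k) \/ ((k < j)%nat /\ x + INR k < 0).
Proof.
  intros [H1 H2]. destruct (Nat.le_gt_cases j k) as [H|H].
  - left. split; [exact H|]. apply le_INR in H. lra.
  - right. split; [exact H|]. destruct H2 as [->|H2]; [lia|].
    assert (H3 : (S k <= j)%nat) by lia. apply le_INR in H3. rewrite S_INR in H3. lra.
Qed.

Lemma between_poles_neq (j k : nat) (x : R) : between_poles j x -> x + INR k <> 0.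
Proof. intros H. destruct (between_poles_sign j k x H); lra. Qed.

Lemma between_poles_mul_pos (j k : nat) (x y : R) :
  between_poles j x -> between_poles j y -> 0 < (x + INR k) * (y + INR k).
Proof.
  intros Hx Hy. destruct (between_poles_sign j k x Hx) as [[Hj ?]|[Hj ?]];
  destruct (between_poles_sign j k y Hy) as [[Hj' ?]|[Hj' ?]]; try lia; nra.
Qed.

Lemma between_poles_convex (j : nat) (x y z : R) :
  between_poles j x -> between_poles j z -> x <= y <= z -> between_poles j y.
Proof.
  intros [H1 H2] [H3 H4] H. split; [lra|]. destruct H4 as [->|H4]; [left; reflexivity|].
  right; lra.
Qed.

Lemma pole_sum_diff (c : R) (n j : nat) (x y : R) :
  between_poles j x -> between_poles j y ->
  pole_sum c n y - pole_sum c n x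
  = (y - x) * psum (fun k => / ((x + INR k) * (y + INR k))) n.
Proof.
  intros Hx Hy. unfold pole_sum. rewrite <- psum_scal.
  rewrite (psum_ext (fun k => (y - x) * / ((x + INR k) * (y + INR k)))
    (fun k => / (x + INR k) + -1 * / (y + INR k))).
  - rewrite psum_plus, (psum_scal (-1)). ring.
  - intros k _. pose proof (between_poles_neq j k x Hx).
    pose proof (between_poles_neq j k y Hy). field. auto.
Qed.

Lemma psum_ge_term (f : nat -> R) (j n : nat) :
  (forall k, 0 <= f k) -> (j < n)%nat -> f j <= psum f n.
Proof.
  intros Hf Hj. apply Rle_trans with (psum f (S j)); [|apply psum_mono; [exact Hf | lia]].
  pose proof (psum_mono f 0 j Hf ltac:(lia)) as H. simpl in *. lra.
Qed.

(** All terms of the difference are positive within a component, and only the one with index j is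
    kept. The bound involves neither c nor n, so strict monotonicity survives the passage to the
    limit. *)
Lemma pole_sum_diff_ge (c : R) (n j : nat) (x y : R) :
  between_poles j x -> between_poles j y -> x <= y -> (j < n)%nat ->
  (y - x) * / ((x + INR j) * (y + INR j)) <= pole_sum c n y - pole_sum c n x.
Proof.
  intros Hx Hy Hxy Hj. rewrite (pole_sum_diff c n j) by assumption.
  apply Rmult_le_compat_l; [lra|].
  apply (psum_ge_term (fun k => / ((x + INR k) * (y + INR k)))); [|exact Hj].
  intros k. apply Rlt_le, Rinv_0_lt_compat, between_poles_mul_pos with j; assumption.
Qed.

Lemma pole_sum_increasing (c : R) (n j : nat) (x y : R) :
  between_poles j x -> between_poles j y -> x < y -> (j < n)%nat ->
  pole_sum c n x < pole_sum c n y.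
Proof.
  intros Hx Hy Hxy Hj.
  pose proof (pole_sum_diff_ge c n j x y Hx Hy ltac:(lra) Hj) as H.
  assert (0 < (y - x) * / ((x + INR j) * (y + INR j))).
  { apply Rmult_lt_0_compat; [lra|]. apply Rinv_0_lt_compat, between_poles_mul_pos with j; assumption. }
  lra.
Qed.

Lemma psi_increasing (j : nat) (x y : R) :
  between_poles j x -> between_poles j y -> x < y -> psi x < psi y.
Proof.
  intros Hx Hy Hxy.
  assert (Hle : Rbar_le ((y - x) * / ((x + INR j) * (y + INR j))) (psi y - psi x)).
  { apply (is_lim_seq_le_loc (fun _ => (y - x) * / ((x + INR j) * (y + INR j)))
      (fun n => pole_sum (ln (INR n)) n y - pole_sum (ln (INR n)) n x)).
    - exists (S j). intros n Hn. apply pole_sum_diff_ge; auto; lra.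
    - apply is_lim_seq_const.
    - apply is_lim_seq_minus'; apply psi_lim. }
  simpl in Hle.
  assert (0 < (y - x) * / ((x + INR j) * (y + INR j))).
  { apply Rmult_lt_0_compat; [lra|]. apply Rinv_0_lt_compat, between_poles_mul_pos with j; assumption. }
  lra.
Qed.

Lemma psum_le_Series (f : nat -> R) (n : nat) :
  (forall k, 0 <= f k) -> ex_series f -> psum f n <= Series f.
Proof.
  intros Hf Hs. pose proof (proj1 (is_series_psum _ _) (Series_correct _ Hs)) as Hl.
  assert (Hle : Rbar_le (psum f n) (Series f)).
  { apply (is_lim_seq_le_loc (fun _ => psum f n) (psum f)).
    - exists n. intros m Hm. apply psum_mono; assumption.
    - apply is_lim_seq_const.
    - exact Hl. }
  exact Hle.
Qed.

(** For x, y in [p, q] the factor 1 / ((x + k)(y + k)) is at most 1 / (p + k)^2 when the component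
    lies right of -k, and at most 1 / (q + k)^2 when it lies left of it. The sum of the two covers
    both cases and is summable. *)
Lemma psi_lipschitz (j : nat) (p q : R) :
  between_poles j p -> between_poles j q ->
  exists C, 0 < C /\
    forall x y, p <= x <= q -> p <= y <= q -> Rabs (psi y - psi x) <= C * Rabs (y - x).
Proof.
  intros Hp Hq.
  set (S1 := Series (fun k => / (p + INR k) ^ 2)).
  set (S2 := Series (fun k => / (q + INR k) ^ 2)).
  assert (Hinv : forall t, between_poles j t -> forall k, 0 < / (t + INR k) ^ 2).
  { intros t Ht k. apply Rinv_0_lt_compat. pose proof (between_poles_mul_pos j k t t Ht Ht). nra. }
  assert (HS : forall t, between_poles j t -> forall n,
    psum (fun k => / (t + INR k) ^ 2) n <= Series (fun k => / (t + INR k) ^ 2)).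
  { intros t Ht n. apply psum_le_Series; [|apply ex_series_inv_sqr].
    intros k. apply Rlt_le, Hinv, Ht. }
  assert (HC : 0 <= S1 /\ 0 <= S2) by (split; [apply (HS p Hp O) | apply (HS q Hq O)]).
  (* The added 1 makes the constant visibly positive, as needed for the division eps / C in the
     continuity proof. *)
  exists (S1 + S2 + 1). split; [lra|].
  intros x y Hx Hy.
  assert (Bx : between_poles j x) by (apply between_poles_convex with p q; assumption).
  assert (By : between_poles j y) by (apply between_poles_convex with p q; assumption).
  assert (Hterm : forall k, 0 <= / ((x + INR k) * (y + INR k)) <=
     / (p + INR k) ^ 2 + / (q + INR k) ^ 2).
  { intros k. pose proof (between_poles_mul_pos j k x y Bx By) as Hxy.
    split; [apply Rlt_le, Rinv_0_lt_compat, Hxy|].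
    pose proof (Hinv p Hp k). pose proof (Hinv q Hq k).
    destruct (between_poles_sign j k p Hp) as [[Hj Hpk]|[Hj Hpk]].
    - apply Rle_trans with (/ (p + INR k) ^ 2); [|lra].
      apply Rinv_le_contravar; [apply pow_lt; lra | nra].
    - destruct (between_poles_sign j k q Hq) as [[Hj' Hqk]|[Hj' Hqk]]; [lia|].
      apply Rle_trans with (/ (q + INR k) ^ 2); [|lra].
      apply Rinv_le_contravar; nra. }
  assert (Hn : forall n, Rabs (pole_sum (ln (INR n)) n y - pole_sum (ln (INR n)) n x)
     <= (S1 + S2) * Rabs (y - x)).
  { intros n. rewrite (pole_sum_diff _ n j) by assumption.
    rewrite Rabs_mult, Rmult_comm. apply Rmult_le_compat_r; [apply Rabs_pos|].
    pose proof (psum_le (fun _ => 0) _ n (fun k _ => proj1 (Hterm k))) as H0.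
    rewrite psum_const, Rmult_0_r in H0.
    rewrite Rabs_pos_eq by exact H0.
    eapply Rle_trans; [apply (psum_le _ _ n (fun k _ => proj2 (Hterm k)))|].
    rewrite psum_plus. apply Rplus_le_compat; apply HS; assumption. }
  assert (Hle : Rbar_le (Rabs (psi y - psi x)) ((S1 + S2) * Rabs (y - x))).
  { eapply is_lim_seq_le; [exact Hn | | apply is_lim_seq_const].
    apply (is_lim_seq_abs _ (Finite (psi y - psi x))).
    apply is_lim_seq_minus'; apply psi_lim. }
  simpl in Hle. pose proof (Rabs_pos (y - x)). lra.
Qed.

Lemma between_poles_open (j : nat) (x : R) :
  between_poles j x -> exists d, 0 < d /\ between_poles j (x - d) /\ between_poles j (x + d).
Proof.
  intros [H1 H2]. destruct H2 as [->|H2].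
  - exists (x / 2). simpl in H1. repeat split; simpl; try lra; left; reflexivity.
  - exists (Rmin (x + INR j) (1 - INR j - x) / 2).
    pose proof (Rmin_l (x + INR j) (1 - INR j - x)).
    pose proof (Rmin_r (x + INR j) (1 - INR j - x)).
    assert (0 < Rmin (x + INR j) (1 - INR j - x)) by (apply Rmin_glb_lt; lra).
    repeat split; try lra; right; lra.
Qed.

Lemma psi_continuous (j : nat) (x : R) : between_poles j x -> continuity_pt psi x.
Proof.
  intros Hx. destruct (between_poles_open j x Hx) as [d [Hd [Hl Hr]]].
  destruct (psi_lipschitz j _ _ Hl Hr) as [C [HC Hlip]].
  intros eps He. exists (Rmin d (eps / C)). split.
  - apply Rmin_glb_lt; [exact Hd | apply Rdiv_lt_0_compat; lra].
  - intros y [_ Hy]. simpl in *. unfold Rdist in *.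
    pose proof (Rmin_l d (eps / C)). pose proof (Rmin_r d (eps / C)).
    assert (Hy' := Rabs_def2 _ _ Hy).
    eapply Rle_lt_trans; [apply Hlip; lra|].
    apply Rlt_le_trans with (C * (eps / C)).
    + apply Rmult_lt_compat_l; lra.
    + right. field. lra.
Qed.

Lemma pole_sum_continuous (c : R) (n j : nat) (x : R) :
  between_poles j x -> continuity_pt (pole_sum c n) x.
Proof.
  intros Hx. unfold pole_sum. apply continuity_pt_minus.
  - apply continuity_pt_const. intros ? ?. reflexivity.
  - induction n as [|n IH]; simpl.
    + apply continuity_pt_const. intros ? ?. reflexivity.
    + apply (continuity_pt_plus (fun y => psum (fun k => / (y + INR k)) n)
        (fun y => / (y + INR n))); [exact IH|].
      apply (continuity_pt_inv (fun y => y + INR n)).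
      * apply continuity_pt_plus; [apply continuity_pt_id|].
        apply continuity_pt_const. intros ? ?. reflexivity.
      * apply between_poles_neq with j. exact Hx.
Qed.

(** * One zero in each component, for the approximations and for psi *)

Lemma IVT_between_poles (f : R -> R) (j : nat) (a b : R) :
  (forall x, between_poles j x -> continuity_pt f x) ->
  (forall x y, between_poles j x -> between_poles j y -> x < y -> f x < f y) ->
  between_poles j a -> between_poles j b -> f a < 0 -> 0 < f b ->
  exists x, a <= x <= b /\ f x = 0.
Proof.
  intros Hc Hinc Ha Hb Fa Fb.
  assert (Hab : a < b).
  { destruct (Rtotal_order a b) as [H|[H|H]]; [exact H | subst; lra|].
    pose proof (Hinc b a Hb Ha H). lra. }
  destruct (IVT_interv f a b) as [x [Hx Hfx]]; try assumption.
  - intros x Hx. apply Hc. apply between_poles_convex with a b; assumption.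
  - exists x. split; assumption.
Qed.

(** At distance 1/D to the right of -j the term of index j equals D. The terms of smaller index are
    at least -2, since 1/D <= 1/2, and those of larger index are positive, so D = |c| + 2j + 2
    outweighs everything else. The bound [x < 1 - INR j] is also asserted for j = 0, where
    membership in the component does not give it; [psi_zero] needs it to shift the point into (1,
    2). *)
Lemma pole_sum_neg (c : R) (n j : nat) :
  (j < n)%nat -> exists x, between_poles j x /\ x < 1 - INR j /\ pole_sum c n x < 0.
Proof.
  intros Hj. pose proof (pos_INR j). pose proof (Rabs_pos c). pose proof (Rle_abs c).
  set (D := Rabs c + 2 * INR j + 2).
  assert (HD : 0 < / D <= / 2).
  { split; [apply Rinv_0_lt_compat | apply Rinv_le_contravar]; unfold D; lra. }
  assert (Hx : between_poles j (- INR j + / D)) by (split; [lra | right; lra]).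
  exists (- INR j + / D). split; [exact Hx|]. split; [lra|].
  unfold pole_sum. replace n with (j + S (n - j - 1))%nat by lia.
  rewrite psum_add, psum_head.
  assert (Hlow : INR j * -2 <= psum (fun k => / (- INR j + / D + INR k)) j).
  { rewrite <- psum_const. apply psum_le. intros k Hk.
    assert (Hkj : (S k <= j)%nat) by lia. apply le_INR in Hkj. rewrite S_INR in Hkj.
    rewrite <- (Ropp_involutive (- INR j + / D + INR k)), Rinv_opp.
    replace (-2) with (- / / 2) by field. apply Ropp_le_contravar, Rinv_le_contravar; lra. }
  assert (Hhigh : INR (n - j - 1) * 0 <=
    psum (fun k => / (- INR j + / D + INR (j + S k))) (n - j - 1)).
  { rewrite <- psum_const. apply psum_le. intros k Hk. rewrite plus_INR.
    pose proof (pos_INR (S k)). apply Rlt_le, Rinv_0_lt_compat. lra. }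
  rewrite Nat.add_0_r.
  replace (/ (- INR j + / D + INR j)) with D by (field; unfold D; lra).
  unfold D in *. lra.
Qed.

(** The mirror situation: just left of the pole -j, hence in component j + 1, the term of index j
    equals -D, the terms of smaller index are negative, and the remaining ones, fewer than n, are at
    most 2 each. *)
Lemma pole_sum_pos (c : R) (n j : nat) :
  (j < n)%nat -> exists x, between_poles (S j) x /\ 0 < pole_sum c n x.
Proof.
  intros Hj. pose proof (pos_INR n). pose proof (Rabs_pos c).
  pose proof (Rle_abs (- c)) as Hc. rewrite Rabs_Ropp in Hc.
  set (D := Rabs c + 2 * INR n + 2).
  assert (HD : 0 < / D <= / 2).
  { split; [apply Rinv_0_lt_compat | apply Rinv_le_contravar]; unfold D; lra. }
  assert (Hx : between_poles (S j) (- INR j - / D))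
    by (split; [|right]; rewrite S_INR; lra).
  exists (- INR j - / D). split; [exact Hx|].
  unfold pole_sum. replace n with (j + S (n - j - 1))%nat at 1 by lia.
  rewrite psum_add, psum_head.
  assert (Hlow : psum (fun k => / (- INR j - / D + INR k)) j <= INR j * 0).
  { rewrite <- psum_const. apply psum_le. intros k Hk. apply lt_INR in Hk.
    apply Rlt_le, Rinv_lt_0_compat. lra. }
  assert (Hhigh : psum (fun k => / (- INR j - / D + INR (j + S k))) (n - j - 1)
    <= INR (n - j - 1) * 2).
  { rewrite <- psum_const. apply psum_le. intros k Hk.
    rewrite plus_INR, S_INR. pose proof (pos_INR k).
    replace 2 with (/ / 2) at 1 by field. apply Rinv_le_contravar; lra. }
  rewrite Nat.add_0_r.
  replace (/ (- INR j - / D + INR j)) with (- D) by (field; unfold D; lra).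
  assert (INR (n - j - 1) <= INR n) by (apply le_INR; lia).
  unfold D in *. lra.
Qed.

Lemma pole_sum_zero (c : R) (n j : nat) :
  0 < c -> (j < n)%nat -> exists x, between_poles j x /\ pole_sum c n x = 0.
Proof.
  intros Hc Hj. destruct (pole_sum_neg c n j Hj) as [a [Ha [_ Fa]]].
  assert (Hb : exists b, between_poles j b /\ 0 < pole_sum c n b).
  { destruct j as [|j]; [|apply pole_sum_pos; lia].
    pose proof (pos_INR n).
    assert (Hq : 0 <= INR n / c) by (apply Rdiv_le_0_compat; lra).
    (* Component 0 has no pole at its right end; there the function tends to c > 0. At n/c + 1 each
       of the n terms is at most 1 / (n/c + 1), and together they stay below c. *)
    exists (INR n / c + 1). split; [split; [simpl; lra | left; reflexivity]|].
    unfold pole_sum.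
    pose proof (psum_le (fun k => / (INR n / c + 1 + INR k)) (fun _ => / (INR n / c + 1)) n) as H1.
    specialize (H1 ltac:(intros k _; pose proof (pos_INR k); apply Rinv_le_contravar; lra)).
    rewrite psum_const in H1.
    assert (INR n * / (INR n / c + 1) < c); [|lra].
    apply Rmult_lt_reg_r with (INR n / c + 1); [lra|].
    rewrite Rmult_assoc, Rinv_l by lra.
    replace (c * (INR n / c + 1)) with (INR n + c) by (field; lra). lra. }
  destruct Hb as [b [Hb Fb]].
  destruct (IVT_between_poles (pole_sum c n) j a b) as [x [Hx Fx]]; try assumption.
  - intros x. apply pole_sum_continuous.
  - intros x y Hx Hy Hxy. apply pole_sum_increasing with j; assumption.
  - exists x. split; [apply between_poles_convex with a b|]; assumption.
Qed.

Lemma pole_sum_le (c d : R) (n : nat) (x : R) : c <= d -> pole_sum c n x <= pole_sum d n x.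
Proof. unfold pole_sum. lra. Qed.

Lemma psi_1_2 (x : R) : 1 < x < 2 -> -1 < psi x < 1.
Proof.
  intros Hx. pose proof (proj2 Euler_gamma_lim).
  assert (H0 : forall t, 0 < t -> between_poles 0 t)
    by (intros t Ht; split; [simpl; lra | left; reflexivity]).
  pose proof (psi_increasing 0 1 x (H0 1 ltac:(lra)) (H0 x ltac:(lra)) ltac:(lra)) as H1.
  pose proof (psi_increasing 0 x 2 (H0 x ltac:(lra)) (H0 2 ltac:(lra)) ltac:(lra)) as H2.
  rewrite psi_1 in H1. rewrite psi_2 in H2. lra.
Qed.

(** By [psi_shift], psi is a [pole_sum] whose constant is a value of psi. Shifting by one more than
    the index of the component lands in (1, 2), where that value lies between -1 and 1, so the
    points found for the constants 1 and -1 provide the two signs. In component 0 the point 2 serves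
    as the positive one. *)
Lemma psi_zero (j : nat) : exists x, between_poles j x /\ psi x = 0.
Proof.
  pose proof (proj2 Euler_gamma_lim).
  assert (Ha : exists a, between_poles j a /\ psi a < 0).
  { destruct (pole_sum_neg 1 (S j) j ltac:(lia)) as [a [Ha [Ha1 Fa]]].
    exists a. split; [exact Ha|]. rewrite (psi_shift a (S j)).
    eapply Rle_lt_trans; [apply pole_sum_le|exact Fa].
    apply Rlt_le, psi_1_2. rewrite S_INR. destruct Ha. lra. }
  assert (Hb : exists b, between_poles j b /\ 0 < psi b).
  { destruct j as [|j].
    - exists 2. split; [split; [simpl; lra | left; reflexivity]|]. rewrite psi_2. lra.
    - destruct (pole_sum_pos (-1) (S (S j)) j ltac:(lia)) as [b [Hb Fb]].
      exists b. split; [exact Hb|]. rewrite (psi_shift b (S (S j))).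
      eapply Rlt_le_trans; [exact Fb|apply pole_sum_le].
      apply Rlt_le, psi_1_2. destruct Hb as [Hb1 [Hb2|Hb2]]; [discriminate|].
      rewrite (S_INR (S j)). lra. }
  destruct Ha as [a [Ha Fa]]. destruct Hb as [b [Hb Fb]].
  destruct (IVT_between_poles psi j a b) as [x [Hx Fx]]; try assumption.
  - intros x. apply psi_continuous.
  - intros x y. apply psi_increasing.
  - exists x. split; [apply between_poles_convex with a b|]; assumption.
Qed.

(** * Rational approximations of psi and their zeros *)

(* [is_poly c n f]: f is a polynomial function of degree at most n whose
   coefficient of x^n is c (Horner form). *)
Fixpoint is_poly (c : R) (n : nat) (f : R -> R) : Prop :=
  match n with
  | O => forall x, f x = c
  | S m => exists (g : R -> R) (d : R), is_poly c m g /\ forall x, f x = x * g x + d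
  end.

Lemma is_poly_ext (c : R) (n : nat) (f g : R -> R) :
  (forall x, f x = g x) -> is_poly c n f -> is_poly c n g.
Proof.
  intros E. destruct n as [|n]; simpl.
  - intros H x. rewrite <- E. apply H.
  - intros [h [d [Hh H]]]. exists h, d. split; [exact Hh|].
    intros x. rewrite <- E. apply H.
Qed.

Lemma is_poly_plus (c d : R) (n : nat) (f g : R -> R) :
  is_poly c n f -> is_poly d n g -> is_poly (c + d) n (fun x => f x + g x).
Proof.
  revert f g. induction n as [|n IH]; simpl; intros f g Hf Hg.
  - intros x. rewrite Hf, Hg. reflexivity.
  - destruct Hf as [f1 [u [Hf1 Hf]]], Hg as [g1 [v [Hg1 Hg]]].
    exists (fun x => f1 x + g1 x), (u + v). split; [apply IH; assumption|].
    intros x. rewrite Hf, Hg. ring.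
Qed.

Lemma is_poly_scal (k c : R) (n : nat) (f : R -> R) :
  is_poly c n f -> is_poly (k * c) n (fun x => k * f x).
Proof.
  revert f. induction n as [|n IH]; simpl; intros f Hf.
  - intros x. rewrite Hf. reflexivity.
  - destruct Hf as [g [u [Hg Hf]]]. exists (fun x => k * g x), (k * u).
    split; [apply IH, Hg|]. intros x. rewrite Hf. ring.
Qed.

Lemma is_poly_raise (c : R) (n : nat) (f : R -> R) : is_poly c n f -> is_poly 0 (S n) f.
Proof.
  revert f. induction n as [|n IH]; intros f Hf.
  - exists (fun _ => 0), c. split; [intros x; reflexivity|].
    intros x. rewrite Hf. ring.
  - destruct Hf as [g [u [Hg Hf]]]. exists g, u. split; [apply IH, Hg | exact Hf].
Qed.

Lemma is_poly_mul_linear (c a : R) (n : nat) (f : R -> R) :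
  is_poly c n f -> is_poly c (S n) (fun x => (x + a) * f x).
Proof.
  intros Hf. replace c with (c + a * 0) by ring.
  apply is_poly_ext with (fun x => (x * f x + 0) + a * f x); [intros x; ring|].
  apply is_poly_plus.
  - exists f, 0. split; [exact Hf | reflexivity].
  - apply is_poly_scal, is_poly_raise with c, Hf.
Qed.

Lemma is_poly_factor (c a : R) (n : nat) (f : R -> R) :
  is_poly c (S n) f -> f a = 0 ->
  exists g, is_poly c n g /\ forall x, f x = (x - a) * g x.
Proof.
  revert f. induction n as [|n IH]; intros f [g [d [Hg Hf]]] Ha.
  - exists g. split; [exact Hg|]. simpl in Hg. rewrite Hf, Hg in Ha.
    intros x. rewrite Hf, !Hg. lra.
  - destruct (IH (fun x => g x - g a)) as [h [Hh Hgh]]; [|ring|].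
    + destruct Hg as [h [e [Hh Hg]]]. exists h, (e - g a).
      split; [exact Hh|]. intros x. rewrite (Hg x). ring.
    + exists (fun x => x * h x + g a). split.
      * exists h, (g a). split; [exact Hh | reflexivity].
      * intros x. rewrite Hf in Ha. rewrite Hf.
        replace (g x) with ((x - a) * h x + g a) by (rewrite <- Hgh; ring). lra.
Qed.

Fixpoint pprod (f : nat -> R) (n : nat) : R :=
  match n with
  | O => 1
  | S m => pprod f m * f m
  end.

Lemma is_poly_roots (c : R) (n : nat) (f : R -> R) (a : nat -> R) :
  is_poly c n f ->
  (forall i j, (i < j < n)%nat -> a i <> a j) ->
  (forall i, (i < n)%nat -> f (a i) = 0) ->
  forall x, f x = c * pprod (fun k => x - a k) n.
Proof.
  revert f. induction n as [|n IH]; intros f Hf Hdist Hroot x.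
  - simpl in *. rewrite Hf. ring.
  - destruct (is_poly_factor c (a n) n f Hf (Hroot n ltac:(lia))) as [g [Hg Hfg]].
    simpl. rewrite Hfg, (IH g); [ring | exact Hg | |].
    + intros i j Hij. apply Hdist. lia.
    + intros i Hi. specialize (Hroot i ltac:(lia)). rewrite Hfg in Hroot.
      apply Rmult_integral in Hroot. destruct Hroot as [H|H]; [|exact H].
      exfalso. apply (Hdist i n); [lia | lra].
Qed.

Lemma is_derive_pprod (a : nat -> R) (n : nat) (x : R) :
  (forall k, (k < n)%nat -> x <> a k) ->
  is_derive (fun y => pprod (fun k => y - a k) n) x
    (pprod (fun k => x - a k) n * psum (fun k => / (x - a k)) n).
Proof.
  induction n as [|n IH]; intros Ha; simpl.
  - auto_derive; [exact I | ring].
  - assert (Hx : x - a n <> 0) by (specialize (Ha n ltac:(lia)); lra).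
    evar_last.
    + apply (is_derive_mult (fun y => pprod (fun k => y - a k) n) (fun y => y - a n)).
      * apply IH. intros k Hk. apply Ha. lia.
      * auto_derive; [exact I | reflexivity].
      * intros; apply Rmult_comm.
    + unfold plus, mult; simpl. field. exact Hx.
Qed.

(** * The numerators and their logarithmic derivatives at 1 and -1 *)

Definition pole_poly (n : nat) (x : R) : R := pprod (fun k => x + INR k) n.

(** This is the numerator of [pole_sum c n] over the common denominator [pole_poly n]. The
    recursion, unlike the product of the two, also has the right value at the poles, where it must
    be evaluated. *)
Fixpoint zero_poly (c : R) (n : nat) (x : R) : R :=
  match n with
  | O => c
  | S m => (x + INR m) * zero_poly c m x - pole_poly m x
  end.

Lemma zero_poly_pole_sum (c : R) (n : nat) (x : R) :
  (forall k, (k < n)%nat -> x + INR k <> 0) ->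
  zero_poly c n x = pole_poly n x * pole_sum c n x.
Proof.
  unfold pole_sum, pole_poly. induction n as [|n IH]; intros Hx; simpl.
  - ring.
  - rewrite IH by (intros; apply Hx; lia). unfold pole_poly. field. apply Hx. lia.
Qed.

Lemma is_poly_pole_poly (n : nat) : is_poly 1 n (pole_poly n).
Proof.
  induction n as [|n IH]; [intros x; reflexivity|].
  apply is_poly_ext with (fun x => (x + INR n) * pole_poly n x).
  - intros x. unfold pole_poly. simpl. ring.
  - apply is_poly_mul_linear, IH.
Qed.

Lemma is_poly_zero_poly (c : R) (n : nat) : is_poly c n (zero_poly c n).
Proof.
  induction n as [|n IH]; [intros x; reflexivity|].
  replace c with (c + -1 * 0) at 1 by ring.
  apply is_poly_ext with (fun x => (x + INR n) * zero_poly c n x + -1 * pole_poly n x).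
  - intros x. simpl. ring.
  - apply is_poly_plus; [apply is_poly_mul_linear, IH|].
    apply is_poly_scal, is_poly_raise with 1, is_poly_pole_poly.
Qed.

Lemma is_derive_pole_poly_S (n : nat) (x q' : R) :
  is_derive (pole_poly n) x q' ->
  is_derive (pole_poly (S n)) x (q' * (x + INR n) + pole_poly n x).
Proof.
  intros Hq. unfold pole_poly at 1. simpl. evar_last.
  - apply (is_derive_mult (pole_poly n) (fun y => y + INR n)).
    + exact Hq.
    + auto_derive; [exact I | reflexivity].
    + intros; apply Rmult_comm.
  - unfold plus, mult; simpl. ring.
Qed.

Lemma is_derive_zero_poly_S (c : R) (n : nat) (x p' q' : R) :
  is_derive (pole_poly n) x q' -> is_derive (zero_poly c n) x p' ->
  is_derive (zero_poly c (S n)) x (zero_poly c n x + (x + INR n) * p' - q').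
Proof.
  intros Hq Hp. simpl. evar_last.
  - apply (is_derive_minus (fun y => (y + INR n) * zero_poly c n y) (pole_poly n)).
    + apply (is_derive_mult (fun y => y + INR n) (zero_poly c n)).
      * auto_derive; [exact I | reflexivity].
      * exact Hp.
      * intros; apply Rmult_comm.
    + exact Hq.
  - unfold minus, plus, opp, mult; simpl. ring.
Qed.

Definition harmonic2 (n : nat) : R := psum (fun k => / (INR k + 1) ^ 2) n.

Lemma INR_fact_S (n : nat) : INR (fact (S n)) = (INR n + 1) * INR (fact n).
Proof. change (fact (S n)) with (S n * fact n)%nat. rewrite mult_INR, S_INR. reflexivity. Qed.

(** At 1 the numerator is n! times [pole_sum], whose derivative there is [harmonic2 n]. The four
    facts are proved together because the recursion for the derivative of [zero_poly] involves the
    other three quantities. *)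
Lemma zero_poly_at_1 (c : R) (n : nat) :
  pole_poly n 1 = INR (fact n) /\
  is_derive (pole_poly n) 1 (INR (fact n) * harmonic n) /\
  zero_poly c n 1 = INR (fact n) * (c - harmonic n) /\
  is_derive (zero_poly c n) 1
    (INR (fact n) * (harmonic n * (c - harmonic n) + harmonic2 n)).
Proof.
  induction n as [|n [Q [Q' [P P']]]].
  - split; [reflexivity | split; [|split]].
    + evar_last; [apply (is_derive_const 1)|]. unfold harmonic. simpl. unfold zero; simpl. ring.
    + unfold harmonic. simpl. ring.
    + evar_last; [apply (is_derive_const c)|].
      unfold harmonic, harmonic2. simpl. unfold zero; simpl. ring.
  - pose proof (pos_INR n).
    rewrite INR_fact_S.
    assert (H1 : harmonic (S n) = harmonic n + / (INR n + 1)) by reflexivity.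
    assert (H2 : harmonic2 (S n) = harmonic2 n + / (INR n + 1) ^ 2) by reflexivity.
    rewrite H1, H2. split; [|split; [|split]].
    + change (pole_poly (S n) 1) with (pole_poly n 1 * (1 + INR n)). rewrite Q. ring.
    + evar_last; [apply is_derive_pole_poly_S, Q'|]. rewrite Q. field. lra.
    + simpl zero_poly. rewrite P, Q. field. lra.
    + evar_last; [apply is_derive_zero_poly_S; [exact Q' | exact P']|].
      rewrite P. field. lra.
Qed.

Lemma zero_poly_at_m1 (c : R) (m : nat) :
  pole_poly (S (S m)) (-1) = 0 /\
  is_derive (pole_poly (S (S m))) (-1) (- INR (fact m)) /\
  zero_poly c (S (S m)) (-1) = INR (fact m) /\
  is_derive (zero_poly c (S (S m))) (-1) (INR (fact m) * (- c - 2 + 2 * harmonic m)).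
Proof.
  induction m as [|m [Q [Q' [P P']]]].
  - unfold harmonic. simpl. unfold pole_poly. simpl. split; [ring | split; [|split; [ring|]]].
    + auto_derive; [exact I | ring].
    + auto_derive; [exact I | ring].
  - pose proof (pos_INR m).
    rewrite INR_fact_S.
    assert (H1 : harmonic (S m) = harmonic m + / (INR m + 1)) by reflexivity.
    assert (Hm : -1 + INR (S (S m)) = INR m + 1) by (rewrite !S_INR; ring).
    rewrite H1. split; [|split; [|split]].
    + change (pole_poly (S (S (S m))) (-1)) with (pole_poly (S (S m)) (-1) * (-1 + INR (S (S m)))).
      rewrite Q. ring.
    + evar_last; [apply is_derive_pole_poly_S, Q'|]. rewrite Q, Hm. ring.
    + change (zero_poly c (S (S (S m))) (-1)) with
        ((-1 + INR (S (S m))) * zero_poly c (S (S m)) (-1) - pole_poly (S (S m)) (-1)).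
      rewrite P, Q, Hm. ring.
    + evar_last; [apply is_derive_zero_poly_S; [exact Q' | exact P']|].
      rewrite P, Hm. field. lra.
Qed.

Lemma between_poles_distinct (i j : nat) (x y : R) :
  (i < j)%nat -> between_poles i x -> between_poles j y -> y < x.
Proof.
  intros Hij Hx Hy.
  destruct (between_poles_sign i i x Hx) as [[_ H1]|[H1 _]]; [|lia].
  destruct (between_poles_sign j i y Hy) as [[H2 _]|[_ H2]]; [lia|]. lra.
Qed.

Lemma sum_over_zeros (c : R) (m : nat) (a : nat -> R) :
  let n := S (S m) in
  c <> harmonic n ->
  (forall k, (k < n)%nat -> between_poles k (a k) /\ pole_sum c n (a k) = 0) ->
  psum (fun k => / (a k ^ 2 - 1)) n =
  (- c - 2 + 2 * harmonic m - (harmonic n + harmonic2 n / (c - harmonic n))) / 2.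
Proof.
  intros n Hc Ha.
  assert (HP : forall x, zero_poly c n x = c * pprod (fun k => x - a k) n).
  { apply is_poly_roots.
    - apply is_poly_zero_poly.
    - intros i j Hij. apply Rgt_not_eq. apply between_poles_distinct with i j; [lia | |]; apply Ha; lia.
    - intros i Hi. destruct (Ha i Hi) as [H1 H2].
      rewrite zero_poly_pole_sum, H2; [ring|].
      intros k _. apply between_poles_neq with i, H1. }
  (* The logarithmic derivative is stated in multiplied form, so that no division by the value of
     the numerator is involved. *)
  assert (Hlog : forall x p', (forall k, (k < n)%nat -> x <> a k) ->
    is_derive (zero_poly c n) x p' ->
    p' = zero_poly c n x * psum (fun k => / (x - a k)) n).
  { intros x p' Hx Hp.
    apply (is_derive_ext _ (fun y => c * pprod (fun k => y - a k) n)) in Hp; [|exact HP].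
    apply is_derive_unique in Hp. rewrite <- Hp, HP. apply is_derive_unique.
    evar_last; [apply is_derive_scal, is_derive_pprod, Hx|]. ring. }
  destruct (zero_poly_at_1 c n) as [_ [_ [P1 P1']]].
  destruct (zero_poly_at_m1 c m) as [_ [_ [P2 P2']]]. fold n in P2, P2'.
  (* At 1 the value of [pole_sum c n] is c - H_n, nonzero by hypothesis; -1 is excluded below as a
     pole. *)
  assert (N1 : forall k, (k < n)%nat -> 1 <> a k).
  { intros k Hk E. destruct (Ha k Hk) as [H1 H2]. rewrite <- E in H2. apply Hc.
    unfold pole_sum in H2. unfold harmonic.
    rewrite (psum_ext _ (fun k => / (1 + INR k))); [lra|]. intros; f_equal; ring. }
  assert (N2 : forall k, (k < n)%nat -> -1 <> a k).
  { intros k Hk E. destruct (Ha k Hk) as [H1 _].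
    apply (between_poles_neq k 1) in H1. rewrite <- E in H1. simpl in H1. lra. }
  apply Hlog in P1'; [|exact N1]. apply Hlog in P2'; [|exact N2].
  rewrite P1 in P1'. rewrite P2 in P2'.
  assert (F1 : INR (fact n) <> 0) by apply INR_fact_neq_0.
  assert (F2 : INR (fact m) <> 0) by apply INR_fact_neq_0.
  apply Rmult_eq_reg_l in P2'; [|exact F2].
  rewrite Rmult_assoc in P1'. apply Rmult_eq_reg_l in P1'; [|exact F1].
  assert (E1 : psum (fun k => / (1 - a k)) n = harmonic n + harmonic2 n / (c - harmonic n)).
  { apply Rmult_eq_reg_l with (c - harmonic n); [|lra]. rewrite <- P1'. field. lra. }
  rewrite <- E1, P2'.
  replace (psum (fun k => / (-1 - a k)) n - psum (fun k => / (1 - a k)) n)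
    with (psum (fun k => / (-1 - a k)) n + -1 * psum (fun k => / (1 - a k)) n) by ring.
  rewrite <- psum_scal, <- psum_plus.
  unfold Rdiv. rewrite Rmult_comm, <- psum_scal. apply psum_ext.
  intros k Hk. specialize (N1 k Hk). specialize (N2 k Hk). field.
  repeat split; try lra.
  intros E. assert (E2 : (a k - 1) * (a k + 1) = 0) by (rewrite <- E; ring).
  apply Rmult_integral in E2. lra.
Qed.

(** * Passage to the limit in the sum over the zeros *)

Lemma harmonic_lim (m : nat) :
  is_lim_seq (fun n => harmonic (n + m) - ln (INR (n + m))) Euler_gamma.
Proof. apply (is_lim_seq_incr_n (fun n => harmonic n - ln (INR n)) m), Euler_gamma_lim. Qed.

(** Once [harmonic m] is expressed through [harmonic (m + 2)], the harmonic numbers and the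
    logarithm occur only as [d], their difference, which tends to gamma; the two dropped terms 1/(m
    + 1) and 1/(m + 2) vanish. Positivity of gamma keeps the denominator away from 0. *)
Lemma sum_over_zeros_lim :
  is_lim_seq (fun m => (- ln (INR (m + 2)) - 2 + 2 * harmonic m -
    (harmonic (m + 2) + harmonic2 (m + 2) / (ln (INR (m + 2)) - harmonic (m + 2)))) / 2)
    (Euler_gamma / 2 + PI ^ 2 / (12 * Euler_gamma) - 1).
Proof.
  pose proof (proj2 Euler_gamma_lim) as Hg.
  set (d := fun m => harmonic (m + 2) - ln (INR (m + 2))).
  assert (Hd : is_lim_seq d Euler_gamma) by apply harmonic_lim.
  assert (Hpos : eventually (fun m => 0 < d m)).
  { destruct (proj1 (is_lim_seq_R _ _) Hd Euler_gamma ltac:(lra)) as [N HN].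
    exists N. intros n Hn. specialize (HN n Hn). apply Rabs_def2 in HN. lra. }
  apply (is_lim_seq_ext_loc (fun m => (d m - 2 - 2 * (1 / (1 + INR m)) - 2 * (1 / (2 + INR m))
    + harmonic2 (m + 2) * / d m) * / 2)).
  - destruct Hpos as [N HN]. exists N. intros m Hm. specialize (HN m Hm).
    pose proof (pos_INR m).
    assert (EH : harmonic m = harmonic (m + 2) - / (1 + INR m) - / (2 + INR m)).
    { rewrite (Nat.add_comm m 2). simpl Nat.add. rewrite !harmonic_S, !S_INR.
      field. lra. }
    assert (EL : ln (INR (m + 2)) = harmonic (m + 2) - d m) by (unfold d; ring).
    rewrite EH, EL. field. repeat split; lra.
  - replace (Euler_gamma / 2 + PI ^ 2 / (12 * Euler_gamma) - 1)
      with ((Euler_gamma - 2 - 2 * 0 - 2 * 0 + PI ^ 2 / 6 * / Euler_gamma) * / 2) by (field; lra).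
    apply (is_lim_seq_scal_r _ (/ 2) (Finite _)).
    apply is_lim_seq_plus'.
    + repeat apply is_lim_seq_minus'; [exact Hd | apply is_lim_seq_const | |];
      apply (is_lim_seq_scal_l _ 2 (Finite 0)), is_lim_seq_div_INR.
    + apply is_lim_seq_mult'.
      * apply (is_lim_seq_incr_n (fun n => harmonic2 n) 2), Basel.
      * apply (is_lim_seq_inv _ (Finite Euler_gamma)); [exact Hd|].
        intros E. injection E. lra.
Qed.

(** Strict monotonicity gives psi(b - d) < 0 < psi(b + d). For large n the approximation has the
    same signs at these two points, and its own monotonicity traps its zero between them. Pointwise
    convergence at two points is all that is used. *)
Lemma pole_sum_zero_lim (k : nat) (b : R) (a : nat -> R) :
  between_poles k b -> psi b = 0 ->
  eventually (fun n => between_poles k (a n) /\ pole_sum (ln (INR n)) n (a n) = 0) ->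
  is_lim_seq a b.
Proof.
  intros Hb Fb Ha. apply is_lim_seq_R. intros eps He.
  destruct (between_poles_open k b Hb) as [d0 [Hd0 [Bl Br]]].
  set (d := Rmin d0 (eps / 2)).
  assert (Hd : 0 < d) by (apply Rmin_glb_lt; lra).
  assert (Hdd : d <= d0) by apply Rmin_l.
  assert (Hde : d <= eps / 2) by apply Rmin_r.
  assert (Bl' : between_poles k (b - d)) by (apply between_poles_convex with (b - d0) b; auto; lra).
  assert (Br' : between_poles k (b + d)) by (apply between_poles_convex with b (b + d0); auto; lra).
  pose proof (psi_increasing k _ _ Bl' Hb ltac:(lra)) as Fl.
  pose proof (psi_increasing k _ _ Hb Br' ltac:(lra)) as Fr.
  rewrite Fb in Fl, Fr.
  destruct (proj1 (is_lim_seq_R _ _) (psi_lim (b - d)) (- psi (b - d)) ltac:(lra)) as [N1 H1].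
  destruct (proj1 (is_lim_seq_R _ _) (psi_lim (b + d)) (psi (b + d)) ltac:(lra)) as [N2 H2].
  destruct Ha as [N3 H3].
  exists (N1 + N2 + N3 + S k)%nat. intros n Hn.
  specialize (H1 n ltac:(lia)). specialize (H2 n ltac:(lia)).
  destruct (H3 n ltac:(lia)) as [Bn Fn].
  apply Rabs_def2 in H1. apply Rabs_def2 in H2.
  assert (b - d < a n).
  { destruct (Rlt_le_dec (b - d) (a n)) as [H|[H|H]]; [exact H| |].
    - pose proof (pole_sum_increasing (ln (INR n)) n k _ _ Bn Bl' H ltac:(lia)). lra.
    - rewrite H in Fn. lra. }
  assert (a n < b + d).
  { destruct (Rlt_le_dec (a n) (b + d)) as [H4|[H4|H4]]; [exact H4| |].
    - pose proof (pole_sum_increasing (ln (INR n)) n k _ _ Br' Bn H4 ltac:(lia)). lra.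
    - rewrite <- H4 in Fn. lra. }
  apply Rabs_def1; lra.
Qed.

Lemma series_over_psi_zeros (b : nat -> R) :
  (forall k, between_poles k (b k)) -> (forall k, psi (b k) = 0) ->
  is_series (fun k => 1 / (b k ^ 2 - 1))
    (Euler_gamma / 2 + PI ^ 2 / (12 * Euler_gamma) - 1).
Proof.
  intros Hb Fb. pose proof (proj2 Euler_gamma_lim) as Hg.
  (* The range conditions sit under the existential so that choice yields a total double sequence,
     arbitrary outside the range; n >= 2 makes ln n positive. *)
  assert (Hex : forall n k, exists x, (k < n)%nat -> (2 <= n)%nat ->
    between_poles k x /\ pole_sum (ln (INR n)) n x = 0).
  { intros n k. destruct (Nat.lt_ge_cases k n) as [Hk|Hk]; [|exists 0; lia].
    destruct (Nat.le_gt_cases 2 n) as [Hn|Hn]; [|exists 0; lia].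
    destruct (pole_sum_zero (ln (INR n)) n k) as [x Hx]; [|exact Hk|exists x; auto].
    rewrite <- ln_1. apply ln_increasing; [lra|]. apply (lt_INR 1). lia. }
  set (a := fun n k => proj1_sig (constructive_indefinite_description _ (Hex n k))).
  assert (Ha : forall n k, (k < n)%nat -> (2 <= n)%nat ->
    between_poles k (a n k) /\ pole_sum (ln (INR n)) n (a n k) = 0).
  { intros n k. unfold a. apply (proj2_sig (constructive_indefinite_description _ (Hex n k))). }
  assert (Hne : forall k, b k ^ 2 - 1 <> 0).
  { intros k E. assert (E2 : (b k - 1) * (b k + 1) = 0) by (rewrite <- E; ring).
    apply Rmult_integral in E2. destruct E2 as [E2|E2].
    - specialize (Fb k). replace (b k) with 1 in Fb by lra. rewrite psi_1 in Fb. lra.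
    - apply (between_poles_neq k 1 (b k) (Hb k)). simpl. lra. }
  (* For k >= 3 the zero lies left of 1 - k, so a^2 - 1 >= (k - 1)^2 - 1 >= (k - 1)(k - 2), and 1 /
     ((k - 1)(k - 2)) telescopes with T k = 1 / (k - 2). The bound fails to be positive for smaller
     k. *)
  apply (tannery (fun n k => 1 / (a n k ^ 2 - 1)) _ (fun k => 1 / (-2 + INR k)) 3).
  - intros k. unfold Rdiv. apply (is_lim_seq_scal_l _ 1 (Finite _)).
    apply (is_lim_seq_inv _ (Finite _)); [|intros E; injection E; apply Hne].
    apply is_lim_seq_minus'; [|apply is_lim_seq_const].
    assert (Hl : is_lim_seq (fun n => a n k) (b k)).
    { apply pole_sum_zero_lim with k; auto. exists (2 + S k)%nat. intros n Hn. apply Ha; lia. }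
    simpl. repeat apply is_lim_seq_mult'; auto. apply is_lim_seq_const.
  - intros n k Hk. destruct (Ha n k ltac:(lia) ltac:(lia)) as [[H1 [H2|H2]] _]; [lia|].
    assert (H3 : 3 <= INR k) by (replace 3 with (INR 3) by (simpl; ring); apply le_INR; lia).
    assert (H4 : (INR k - 2) * (INR k - 1) <= a n k ^ 2 - 1) by nra.
    rewrite S_INR.
    replace (1 / (-2 + INR k) - 1 / (-2 + (INR k + 1)))
      with (/ ((INR k - 2) * (INR k - 1))) by (field; lra).
    assert (H5 : 0 < (INR k - 2) * (INR k - 1)) by (apply Rmult_lt_0_compat; lra).
    unfold Rdiv. rewrite Rmult_1_l, Rabs_pos_eq.
    + apply Rinv_le_contravar; assumption.
    + apply Rlt_le, Rinv_0_lt_compat. lra.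
  - intros k Hk. assert (H3 : 3 <= INR k) by (replace 3 with (INR 3) by (simpl; ring); apply le_INR; lia).
    apply Rlt_le, Rdiv_lt_0_compat; lra.
  - apply is_lim_seq_div_INR.
  (* The closed form is stated for n = m + 2. It applies for large m, because H_n - ln n tends to
     gamma > 0 and so ln n differs from H_n. *)
  - apply (is_lim_seq_incr_n _ 2).
    eapply is_lim_seq_ext_loc; [|exact sum_over_zeros_lim].
    destruct (proj1 (is_lim_seq_R _ _) (harmonic_lim 2) Euler_gamma ltac:(lra)) as [N HN].
    exists N. intros m Hm. specialize (HN m Hm). apply Rabs_def2 in HN.
    rewrite (Nat.add_comm m 2) in *. simpl Nat.add in *.
    rewrite <- (sum_over_zeros _ m (a (S (S m)))).
    + apply psum_ext. intros k _. unfold Rdiv. ring.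
    + lra.
    + intros k Hk. apply Ha; lia.
Qed.

(** * The real Gamma function *)

Notation is_RInt_0_oo f := (is_RInt_gen f (at_right 0) (Rbar_locally p_infty)).

Lemma filter_prod_0_oo (a0 b0 : R) (P : R * R -> Prop) :
  0 < a0 -> (forall a b, 0 < a <= a0 -> b0 <= b -> P (a, b)) ->
  filter_prod (at_right 0) (Rbar_locally p_infty) P.
Proof.
  intros Ha0 HP. apply Filter_prod with (fun a => 0 < a <= a0) (fun b => b0 <= b).
  - exists (mkposreal a0 Ha0). intros a Ha Ha'. split; [exact Ha'|].
    unfold ball in Ha; simpl in Ha. unfold AbsRing_ball, abs, minus, plus, opp in Ha; simpl in Ha.
    apply Rabs_def2 in Ha. lra.
  - exists b0. intros b Hb. lra.
  - exact HP.
Qed.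

Lemma is_RInt_0_oo_unique (f : R -> R) (l : R) :
  is_RInt_0_oo f l ->
  RInt_gen (V := R_CompleteNormedModule) f (at_right 0) (Rbar_locally p_infty) = l.
Proof.
  exact (is_RInt_gen_unique (V := R_CompleteNormedModule)
           (Fa := at_right 0) (Fb := Rbar_locally p_infty) f l).
Qed.

Lemma RInt_pos_ex (f : R -> R) (a b : R) :
  (forall t, 0 < t -> continuous f t) -> 0 < a -> a <= b -> ex_RInt f a b.
Proof.
  intros Hf Ha Hab. apply (ex_RInt_continuous (V := R_CompleteNormedModule)).
  intros t Ht. rewrite Rmin_left in Ht by exact Hab. apply Hf. lra.
Qed.

(** For a nonnegative integrand the integral grows with the interval, so the supremum over compact
    intervals is the limit. The second conclusion later gives positivity of Gamma by comparison with
    [1, 2]. *)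
Lemma is_RInt_0_oo_sup (f : R -> R) (M : R) :
  (forall t, 0 < t -> continuous f t) -> (forall t, 0 < t -> 0 <= f t) ->
  (forall a b, 0 < a -> a <= b -> RInt f a b <= M) ->
  exists l, is_RInt_0_oo f l /\ forall a b, 0 < a -> a <= b -> RInt f a b <= l.
Proof.
  intros Hc Hpos HM.
  destruct (completeness (fun v => exists a b, 0 < a /\ a <= b /\ v = RInt f a b)) as [l [Hup Hleast]].
  - exists M. intros v [a [b [Ha [Hab ->]]]]. apply HM; assumption.
  - exists (RInt f 1 1), 1, 1. repeat split; lra.
  - assert (Hl : forall a b, 0 < a -> a <= b -> RInt f a b <= l).
    { intros a b Ha Hab. apply Hup. exists a, b. auto. }
    exists l. split; [|exact Hl].
    intros P [eps HP].
    assert (Hx : exists a b, 0 < a /\ a <= b /\ l - eps < RInt f a b).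
    { apply NNPP. intros Hn.
      assert (Hb : l <= l - eps).
      { apply Hleast. intros v [a [b [Ha [Hab ->]]]].
        apply Rnot_lt_le. intros H. apply Hn. exists a, b. auto. }
      destruct eps as [e He]. simpl in Hb. lra. }
    destruct Hx as [a0 [b0 [Ha0 [Hab0 Hlt]]]].
    apply (filter_prod_0_oo a0 b0); [exact Ha0|].
    intros a b Ha Hb. exists (RInt f a b). split.
    + apply (RInt_correct (V := R_CompleteNormedModule)). apply RInt_pos_ex; simpl; auto; lra.
    + apply HP. change (Rabs (RInt f a b - l) < eps).
      assert (Hge : RInt f a0 b0 <= RInt f a b).
      { rewrite <- (RInt_Chasles f a a0 b) by (apply RInt_pos_ex; auto; lra).
        rewrite <- (RInt_Chasles f a0 b0 b) by (apply RInt_pos_ex; auto; lra).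
        assert (0 <= RInt f a a0).
        { apply RInt_ge_0; [lra | apply RInt_pos_ex; auto; lra | intros; apply Hpos; lra]. }
        assert (0 <= RInt f b0 b).
        { apply RInt_ge_0; [lra | apply RInt_pos_ex; auto; lra | intros; apply Hpos; lra]. }
        unfold plus; simpl. lra. }
      specialize (Hl a b ltac:(lra) ltac:(lra)).
      apply Rabs_def1; destruct eps as [e He]; simpl in *; lra.
Qed.

Lemma is_RInt_0_oo_antiderivative (F f : R -> R) (la lb : R) :
  (forall t, 0 < t -> is_derive F t (f t)) -> (forall t, 0 < t -> continuous f t) ->
  filterlim F (at_right 0) (locally la) ->
  filterlim F (Rbar_locally p_infty) (locally lb) ->
  is_RInt_0_oo f (lb - la).
Proof.
  intros HF Hf Hla Hlb P [eps HP].
  assert (He2 : 0 < eps / 2) by (destruct eps as [e He]; simpl; lra).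
  assert (Ha := proj1 (filterlim_locally F la) Hla (mkposreal _ He2)).
  assert (Hb := proj1 (filterlim_locally F lb) Hlb (mkposreal _ He2)).
  assert (Hpos : at_right 0 (fun t => 0 < t)) by (exists (mkposreal 1 Rlt_0_1); auto).
  assert (Hpos' : Rbar_locally p_infty (fun t => 0 < t)) by (exists 0; auto).
  eapply Filter_prod.
  - exact (filter_and _ _ Hpos Ha).
  - exact (filter_and _ _ Hpos' Hb).
  - intros a b [Ha0 Ba] [Hb0 Bb]. simpl. exists (F b - F a). split.
    + apply (is_RInt_derive (V := R_CompleteNormedModule) F f).
      * intros t Ht. apply HF. eapply Rlt_le_trans; [|apply Ht]. apply Rmin_glb_lt; assumption.
      * intros t Ht. apply Hf. eapply Rlt_le_trans; [|apply Ht]. apply Rmin_glb_lt; assumption.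
    + apply HP. change (Rabs (F b - F a - (lb - la)) < eps).
      change (Rabs (F a - la) < eps / 2) in Ba. change (Rabs (F b - lb) < eps / 2) in Bb.
      replace (F b - F a - (lb - la)) with ((F b - lb) - (F a - la)) by ring.
      eapply Rle_lt_trans; [apply Rabs_triang|]. rewrite Rabs_Ropp. lra.
Qed.

Lemma is_RInt_0_oo_le (f g : R -> R) (lf lg : R) :
  (forall t, 0 < t -> 0 <= f t <= g t) -> is_RInt_0_oo f lf -> is_RInt_0_oo g lg -> lf <= lg.
Proof.
  intros Hfg Hf Hg.
  apply Rle_trans with (norm lf); [apply Rle_abs|].
  apply (RInt_gen_norm (V := R_CompleteNormedModule) (Fa := at_right 0)
           (Fb := Rbar_locally p_infty) f g lf lg).
  - apply (filter_prod_0_oo 1 1); [lra|]. simpl; intros; lra.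
  - apply (filter_prod_0_oo 1 1); [lra|]. simpl. intros a b Ha Hb t Ht.
    change (Rabs (f t) <= g t).
    destruct (Hfg t ltac:(lra)). rewrite Rabs_pos_eq; assumption.
  - exact Hf.
  - exact Hg.
Qed.

(** * Euler's integral: convergence and functional equation *)

Definition Gamma_integrand (x t : R) : R := exp ((x - 1) * ln t) * exp (- t).

Lemma Gamma_integrand_pos (x t : R) : 0 < Gamma_integrand x t.
Proof. apply Rmult_lt_0_compat; apply exp_pos. Qed.

Lemma Gamma_integrand_continuous (x t : R) : 0 < t -> continuous (Gamma_integrand x) t.
Proof.
  intros Ht. apply (ex_derive_continuous (V := R_NormedModule)).
  unfold Gamma_integrand. auto_derive. exact Ht.
Qed.

Lemma Gamma_integrand_alt (x t : R) :
  0 < t -> Gamma_integrand x t = exp (x * ln t) * / t * exp (- t).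
Proof.
  intros Ht. unfold Gamma_integrand.
  replace ((x - 1) * ln t) with (x * ln t + - ln t) by ring.
  rewrite exp_plus, exp_Ropp, exp_ln by exact Ht. reflexivity.
Qed.

(** The function x ln t - t is largest at t = x. This single estimate supplies both the convergence
    of Euler's integral and the decay of t^x exp(-t) at infinity. *)
Lemma mul_ln_le (x t : R) : 0 < x -> 0 < t -> x * ln t <= t - x + x * ln x.
Proof.
  intros Hx Ht.
  pose proof (ln_le_minus_1 (t / x) (Rdiv_lt_0_compat _ _ Ht Hx)) as H.
  rewrite ln_div in H by assumption.
  apply Rmult_le_compat_l with (r := x) in H; [|lra].
  replace (x * (t / x - 1)) with (t - x) in H by (field; lra). lra.
Qed.

(* The integrand is dominated by a multiple of the derivative of
   (t / (1 + t))^x, whose values lie between 0 and 1. *)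
Lemma Gamma_integral_bounded (x : R) :
  0 < x -> exists M, forall a b, 0 < a -> a <= b -> RInt (Gamma_integrand x) a b <= M.
Proof.
  intros Hx.
  (* [mul_ln_le] with exponent x + 1 at 1 + t gives exp(-t) <= K (1 + t)^(-x-1), while F' is x
     t^(x-1) (1 + t)^(-x-1); hence the factor K / x. *)
  set (K := exp (- x + (x + 1) * ln (x + 1))).
  set (F := fun t => exp (x * (ln t - ln (1 + t)))).
  set (F' := fun t => F t * (x * (/ t - / (1 + t)))).
  assert (HF : forall t, 0 < t -> is_derive F t (F' t)).
  { intros t Ht. unfold F', F. auto_derive; [lra | unfold Rminus; field; lra]. }
  assert (HF' : forall t, 0 < t -> continuous F' t).
  { intros t Ht. apply (ex_derive_continuous (V := R_NormedModule)).
    unfold F', F. auto_derive. repeat split; lra. }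
  assert (Hle : forall t, 0 < t -> Gamma_integrand x t <= K / x * F' t).
  { intros t Ht. rewrite Gamma_integrand_alt by exact Ht.
    replace (K / x * F' t) with (exp (x * ln t) * / t * (K * exp (- (x + 1) * ln (1 + t)))).
    - apply Rmult_le_compat_l.
      + apply Rlt_le, Rmult_lt_0_compat; [apply exp_pos | apply Rinv_0_lt_compat, Ht].
      + unfold K. rewrite <- exp_plus.
        pose proof (mul_ln_le (x + 1) (1 + t) ltac:(lra) ltac:(lra)) as H.
        assert (E : - t <= - x + (x + 1) * ln (x + 1) + - (x + 1) * ln (1 + t)) by lra.
        destruct E as [E|E]; [apply Rlt_le, exp_increasing, E | rewrite E; lra].
    - unfold F', F.
      replace (x * (ln t - ln (1 + t))) with (x * ln t + - (x * ln (1 + t))) by ring.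
      replace (- (x + 1) * ln (1 + t)) with (- (x * ln (1 + t)) + - ln (1 + t)) by ring.
      rewrite !exp_plus, (exp_Ropp (ln (1 + t))), exp_ln by lra.
      field. lra. }
  exists (K / x). intros a b Ha Hab.
  assert (HI : is_RInt (fun t => K / x * F' t) a b (K / x * (F b - F a))).
  { apply (is_RInt_scal (V := R_NormedModule)), (is_RInt_derive (V := R_CompleteNormedModule));
    rewrite Rmin_left, Rmax_right by lra; intros t Ht; [apply HF | apply HF']; lra. }
  assert (HK : 0 < K / x) by (apply Rdiv_lt_0_compat; [apply exp_pos | exact Hx]).
  apply Rle_trans with (K / x * (F b - F a)).
  - rewrite <- (is_RInt_unique _ _ _ _ HI). apply RInt_le; [exact Hab | | eexists; exact HI |].
    + apply RInt_pos_ex; auto. intros; apply Gamma_integrand_continuous; assumption.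
    + intros t Ht. apply Hle. lra.
  - assert (F b <= 1).
    { unfold F. apply Rle_trans with (exp 0); [|rewrite exp_0; lra].
      pose proof (ln_increasing b (1 + b) ltac:(lra) ltac:(lra)).
      apply Rlt_le, exp_increasing. nra. }
    assert (0 < F a) by apply exp_pos. nra.
Qed.

Definition RGamma (x : R) : R :=
  RInt_gen (V := R_CompleteNormedModule) (Gamma_integrand x) (at_right 0) (Rbar_locally p_infty).

Lemma RGamma_spec (x : R) :
  0 < x -> is_RInt_0_oo (Gamma_integrand x) (RGamma x) /\ 0 < RGamma x.
Proof.
  intros Hx. destruct (Gamma_integral_bounded x Hx) as [M HM].
  destruct (is_RInt_0_oo_sup (Gamma_integrand x) M) as [l [Hl Hle]].
  - apply Gamma_integrand_continuous.
  - intros t _. apply Rlt_le, Gamma_integrand_pos.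
  - exact HM.
  - assert (E : RGamma x = l) by exact (is_RInt_0_oo_unique _ _ Hl).
    rewrite E. split; [exact Hl|].
    apply Rlt_le_trans with (RInt (Gamma_integrand x) 1 2); [|apply Hle; lra].
    apply RInt_gt_0; [lra | intros; apply Gamma_integrand_pos |].
    intros t Ht. apply Gamma_integrand_continuous. lra.
Qed.

Lemma pow_exp_lim_0 (x : R) :
  0 < x -> filterlim (fun t => - exp (x * ln t) * exp (- t)) (at_right 0) (locally 0).
Proof.
  intros Hx. apply filterlim_locally. intros eps.
  exists (mkposreal _ (exp_pos (ln eps / x))). intros t Ht Ht0.
  change (Rabs (t - 0) < exp (ln eps / x)) in Ht.
  change (Rabs (- exp (x * ln t) * exp (- t) - 0) < eps).
  rewrite Rminus_0_r in *. rewrite Rabs_pos_eq in Ht by lra.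
  assert (He := cond_pos eps).
  replace (- exp (x * ln t) * exp (- t)) with (- (exp (x * ln t) * exp (- t))) by ring.
  rewrite Rabs_Ropp, Rabs_pos_eq, <- exp_plus.
  - rewrite <- (exp_ln eps) by exact He. apply exp_increasing.
    apply ln_increasing in Ht; [|exact Ht0]. rewrite ln_exp in Ht.
    apply Rmult_lt_compat_l with (r := x) in Ht; [|exact Hx].
    replace (x * (ln eps / x)) with (ln eps) in Ht by (field; lra). lra.
  - apply Rlt_le, Rmult_lt_0_compat; apply exp_pos.
Qed.

Lemma pow_exp_lim_oo (x : R) :
  0 < x -> filterlim (fun t => - exp (x * ln t) * exp (- t)) (Rbar_locally p_infty) (locally 0).
Proof.
  intros Hx. apply filterlim_locally. intros eps.
  assert (He := cond_pos eps).
  (* [mul_ln_le] with exponent 2x reads 2x ln t <= t + B, so x ln t - t <= (B - t) / 2, which falls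
     below ln eps once t > B - 2 ln eps. *)
  set (B := - (2 * x) + 2 * x * ln (2 * x)).
  exists (Rmax 0 (B - 2 * ln eps)). intros t Ht.
  assert (Ht0 : 0 < t) by (eapply Rle_lt_trans; [apply Rmax_l | exact Ht]).
  assert (Ht1 : B - 2 * ln eps < t) by (eapply Rle_lt_trans; [apply Rmax_r | exact Ht]).
  change (Rabs (- exp (x * ln t) * exp (- t) - 0) < eps).
  rewrite Rminus_0_r.
  replace (- exp (x * ln t) * exp (- t)) with (- (exp (x * ln t) * exp (- t))) by ring.
  rewrite Rabs_Ropp, Rabs_pos_eq, <- exp_plus.
  - rewrite <- (exp_ln eps) by exact He. apply exp_increasing.
    pose proof (mul_ln_le (2 * x) t ltac:(lra) Ht0) as H. unfold B in *. lra.
  - apply Rlt_le, Rmult_lt_0_compat; apply exp_pos.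
Qed.

(** Integration by parts in integrated form: t^x exp(-t) - x t^(x-1) exp(-t) is the derivative of
    -t^x exp(-t), which tends to 0 at both ends. *)
Lemma RGamma_succ (x : R) : 0 < x -> RGamma (x + 1) = x * RGamma x.
Proof.
  intros Hx.
  destruct (RGamma_spec x Hx) as [H1 _].
  destruct (RGamma_spec (x + 1) ltac:(lra)) as [H2 _].
  assert (H3 : is_RInt_0_oo (fun t => Gamma_integrand (x + 1) t - x * Gamma_integrand x t) (0 - 0)).
  { apply (is_RInt_0_oo_antiderivative (fun t => - exp (x * ln t) * exp (- t))).
    - intros t Ht. rewrite (Gamma_integrand_alt x) by exact Ht.
      unfold Gamma_integrand. replace (x + 1 - 1) with x by ring.
      auto_derive; [exact Ht | field; lra].
    - intros t Ht. apply (continuous_minus (V := R_NormedModule)).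
      + apply Gamma_integrand_continuous, Ht.
      + apply (continuous_scal_r (V := R_NormedModule) x), Gamma_integrand_continuous, Ht.
    - apply pow_exp_lim_0, Hx.
    - apply pow_exp_lim_oo, Hx. }
  apply (is_RInt_gen_scal (V := R_NormedModule) _ x) in H1.
  pose proof (is_RInt_gen_minus (V := R_NormedModule) _ _ _ _ H2 H1) as H4.
  apply is_RInt_0_oo_unique in H3. apply is_RInt_0_oo_unique in H4.
  assert (E : minus (RGamma (x + 1)) (scal x (RGamma x)) = 0 - 0).
  { exact (eq_trans (eq_sym H4) H3). }
  unfold minus, plus, opp, scal in E; simpl in E. unfold mult in E; simpl in E. lra.
Qed.

(** * Log-convexity and the derivative of Gamma *)

Lemma exp_convex (p q s : R) :
  0 <= s <= 1 -> exp (s * p + (1 - s) * q) <= s * exp p + (1 - s) * exp q.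
Proof.
  intros Hs. set (r := s * p + (1 - s) * q).
  assert (H : forall u, exp r * (1 + (u - r)) <= exp u).
  { intros u. replace u with (r + (u - r)) at 2 by ring. rewrite exp_plus.
    apply Rmult_le_compat_l; [apply Rlt_le, exp_pos | apply exp_ineq1_le]. }
  pose proof (Rmult_le_compat_l s _ _ (proj1 Hs) (H p)) as Hp.
  pose proof (Rmult_le_compat_l (1 - s) _ _ ltac:(lra) (H q)) as Hq.
  replace (exp r) with (s * (exp r * (1 + (p - r))) + (1 - s) * (exp r * (1 + (q - r))))
    by (unfold r; ring).
  lra.
Qed.

(* Hoelder's inequality, in the form of Young's inequality applied to the two
   normalised integrands. *)
Lemma ln_RGamma_convex (a b s : R) :
  0 < a -> 0 < b -> 0 <= s <= 1 ->
  ln (RGamma (s * a + (1 - s) * b)) <= s * ln (RGamma a) + (1 - s) * ln (RGamma b).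
Proof.
  intros Ha Hb Hs.
  assert (Hm : 0 < s * a + (1 - s) * b).
  { destruct (Rle_lt_dec s (1 / 2)); nra. }
  destruct (RGamma_spec a Ha) as [Ia Ga]. destruct (RGamma_spec b Hb) as [Ib Gb].
  destruct (RGamma_spec _ Hm) as [Im Gm].
  (* [W] is Gamma(a)^s Gamma(b)^(1-s). The weights put on the two integrals below are such that
     their sum is exactly [W]. *)
  set (W := exp (s * ln (RGamma a) + (1 - s) * ln (RGamma b))).
  assert (HW : 0 < W) by apply exp_pos.
  rewrite <- (ln_exp (s * ln (RGamma a) + (1 - s) * ln (RGamma b))).
  apply ln_le; [exact Gm|]. fold W.
  apply (is_RInt_gen_scal (V := R_NormedModule) _ (W * s / RGamma a)) in Ia.
  apply (is_RInt_gen_scal (V := R_NormedModule) _ (W * (1 - s) / RGamma b)) in Ib.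
  pose proof (is_RInt_gen_plus (V := R_NormedModule) _ _ _ _ Ia Ib) as Iab.
  apply Rle_trans with (plus (scal (W * s / RGamma a) (RGamma a))
                             (scal (W * (1 - s) / RGamma b) (RGamma b))).
  - refine (is_RInt_0_oo_le _ _ _ _ _ Im Iab). intros t Ht.
    split; [apply Rlt_le, Gamma_integrand_pos|].
    assert (HE : forall c, 0 < RGamma c ->
      exp ((c - 1) * ln t - t - ln (RGamma c)) = Gamma_integrand c t / RGamma c).
    { intros c Hc.
      replace ((c - 1) * ln t - t - ln (RGamma c))
        with ((c - 1) * ln t + - t + - ln (RGamma c)) by ring.
      rewrite exp_plus, exp_plus, (exp_Ropp (ln _)), exp_ln by exact Hc. reflexivity. }
    pose proof (exp_convex ((a - 1) * ln t - t - ln (RGamma a))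
       ((b - 1) * ln t - t - ln (RGamma b)) s Hs) as H.
    apply Rmult_le_compat_l with (r := W) in H; [|lra].
    unfold W in H at 1. rewrite <- exp_plus in H.
    unfold Gamma_integrand at 1. rewrite <- exp_plus.
    replace ((s * a + (1 - s) * b - 1) * ln t + - t) with
      (s * ln (RGamma a) + (1 - s) * ln (RGamma b) +
       (s * ((a - 1) * ln t - t - ln (RGamma a)) +
        (1 - s) * ((b - 1) * ln t - t - ln (RGamma b)))) by ring.
    eapply Rle_trans; [exact H|]. right.
    rewrite !HE by assumption.
    unfold plus, scal; simpl. unfold mult; simpl. field. lra.
  - right. unfold plus, scal; simpl. unfold mult; simpl. field. lra.
Qed.

Lemma ln_RGamma_slopes (u v w : R) :
  0 < u -> u < v -> v < w ->
  (ln (RGamma v) - ln (RGamma u)) * (w - v) <= (ln (RGamma w) - ln (RGamma v)) * (v - u).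
Proof.
  intros Hu Huv Hvw.
  assert (Hs : 0 <= (w - v) / (w - u) <= 1).
  { split; [apply Rdiv_le_0_compat; lra|].
    apply Rmult_le_reg_r with (w - u); [lra|].
    unfold Rdiv. rewrite Rmult_assoc, Rinv_l; lra. }
  pose proof (ln_RGamma_convex u w ((w - v) / (w - u)) ltac:(lra) ltac:(lra) Hs) as H.
  replace ((w - v) / (w - u) * u + (1 - (w - v) / (w - u)) * w) with v in H by (field; lra).
  apply Rmult_le_compat_r with (r := w - u) in H; [|lra].
  replace (((w - v) / (w - u) * ln (RGamma u) + (1 - (w - v) / (w - u)) * ln (RGamma w)) * (w - u))
    with ((w - v) * ln (RGamma u) + (v - u) * ln (RGamma w)) in H by (field; lra).
  lra.
Qed.

Lemma ln_RGamma_succ (x : R) : 0 < x -> ln (RGamma (x + 1)) = ln x + ln (RGamma x).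
Proof.
  intros Hx. rewrite RGamma_succ by exact Hx. apply ln_mult; [exact Hx|].
  apply RGamma_spec, Hx.
Qed.

(** By convexity the slope over [u, v] lies between those over [u - 1, u] and [v, v + 1], which the
    functional equation evaluates as ln (u - 1) and ln v. The bounds are widened to y - 2 and y + 1
    so as to be free of h and of its sign. *)
Lemma ln_RGamma_quotient_bounds (y h : R) :
  2 < y -> h <> 0 -> -1 < h < 1 ->
  ln (y - 2) <= (ln (RGamma (y + h)) - ln (RGamma y)) / h <= ln (y + 1).
Proof.
  intros Hy Hh0 Hh.
  assert (Hs : forall u v, 1 < u -> u < v -> v < u + 1 ->
    ln (u - 1) <= (ln (RGamma v) - ln (RGamma u)) / (v - u) <= ln v).
  { intros u v Hu Huv Hvu.
    pose proof (ln_RGamma_slopes (u - 1) u v ltac:(lra) ltac:(lra) ltac:(lra)) as H1.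
    pose proof (ln_RGamma_slopes u v (v + 1) ltac:(lra) ltac:(lra) ltac:(lra)) as H2.
    rewrite (ln_RGamma_succ v) in H2 by lra.
    pose proof (ln_RGamma_succ (u - 1) ltac:(lra)) as E.
    replace (u - 1 + 1) with u in E by ring. rewrite E in H1 at 1.
    split; apply Rmult_le_reg_r with (v - u); try lra;
    unfold Rdiv; rewrite Rmult_assoc, Rinv_l by lra; lra. }
  destruct (Rtotal_order h 0) as [H|[H|H]]; [| contradiction |].
  - destruct (Hs (y + h) y ltac:(lra) ltac:(lra) ltac:(lra)) as [H1 H2].
    replace ((ln (RGamma y) - ln (RGamma (y + h))) / (y - (y + h)))
      with ((ln (RGamma (y + h)) - ln (RGamma y)) / h) in * by (field; lra).
    pose proof (ln_increasing (y - 2) (y + h - 1) ltac:(lra) ltac:(lra)).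
    pose proof (ln_increasing y (y + 1) ltac:(lra) ltac:(lra)). lra.
  - destruct (Hs y (y + h) ltac:(lra) ltac:(lra) ltac:(lra)) as [H1 H2].
    replace (y + h - y) with h in * by ring.
    pose proof (ln_increasing (y - 2) (y - 1) ltac:(lra) ltac:(lra)).
    pose proof (ln_increasing (y + h) (y + 1) ltac:(lra) ltac:(lra)). lra.
Qed.

Lemma ln_RGamma_add (x : R) (n : nat) :
  0 < x -> ln (RGamma (x + INR n)) = psum (fun k => ln (x + INR k)) n + ln (RGamma x).
Proof.
  intros Hx. induction n as [|n IH]; [simpl; rewrite Rplus_0_r; ring|].
  pose proof (pos_INR n).
  rewrite S_INR, <- Rplus_assoc, ln_RGamma_succ, IH by lra. simpl. ring.
Qed.

Lemma is_derive_psum_ln (x : R) (n : nat) :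
  0 < x -> is_derive (fun y => psum (fun k => ln (y + INR k)) n) x (psum (fun k => / (x + INR k)) n).
Proof.
  intros Hx. induction n as [|n IH]; simpl; [apply (is_derive_const 0)|].
  apply (is_derive_plus (fun y => psum (fun k => ln (y + INR k)) n) (fun y => ln (y + INR n))).
  - exact IH.
  - pose proof (pos_INR n). auto_derive; [lra | field; lra].
Qed.

(* By the functional equation a difference quotient of ln Gamma at x is one at
   x + n minus that of sum_{k<n} ln(x+k); by convexity the former is ln n + o(1)
   uniformly in the increment. *)
Lemma is_derive_ln_RGamma (x : R) : 0 < x -> is_derive (fun y => ln (RGamma y)) x (psi x).
Proof.
  intros Hx. apply is_derive_Reals. intros eps He.
  assert (He3 : 0 < eps / 3) by lra.
  destruct (proj1 (is_lim_seq_R _ _) (psi_lim x) _ He3) as [N1 H1].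
  destruct (proj1 (is_lim_seq_R _ _) (ln_shift_lim (x - 2)) _ He3) as [N2 H2].
  destruct (proj1 (is_lim_seq_R _ _) (ln_shift_lim (x + 1)) _ He3) as [N3 H3].
  set (n := (N1 + N2 + N3 + 2)%nat).
  assert (Hn : 2 <= INR n) by (apply (le_INR 2); unfold n; lia).
  specialize (H1 n ltac:(lia)). specialize (H2 n ltac:(lia)). specialize (H3 n ltac:(lia)).
  destruct (proj1 (is_derive_Reals _ _ _) (is_derive_psum_ln x n Hx) _ He3) as [d Hd].
  assert (Hdel : 0 < Rmin d (Rmin 1 x)).
  { apply Rmin_glb_lt; [apply cond_pos | apply Rmin_glb_lt; lra]. }
  exists (mkposreal _ Hdel). simpl. intros h Hh0 Hh.
  assert (Hhd : Rabs h < d) by (eapply Rlt_le_trans; [exact Hh | apply Rmin_l]).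
  assert (Hh' : Rabs h < Rmin 1 x) by (eapply Rlt_le_trans; [exact Hh | apply Rmin_r]).
  assert (Hh1 : Rabs h < 1) by (eapply Rlt_le_trans; [exact Hh' | apply Rmin_l]).
  assert (Hhx : Rabs h < x) by (eapply Rlt_le_trans; [exact Hh' | apply Rmin_r]).
  apply Rabs_def2 in Hh1. apply Rabs_def2 in Hhx.
  specialize (Hd h Hh0 Hhd).
  pose proof (ln_RGamma_quotient_bounds (x + INR n) h ltac:(lra) Hh0 ltac:(lra)) as Hq.
  replace (x + INR n + h) with (x + h + INR n) in Hq by ring.
  rewrite (ln_RGamma_add x n), (ln_RGamma_add (x + h) n) in Hq by lra.
  set (D := (psum (fun k => ln (x + h + INR k)) n - psum (fun k => ln (x + INR k)) n) / h) in *.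
  set (L := (ln (RGamma (x + h)) - ln (RGamma x)) / h) in *.
  match type of Hq with _ <= ?q <= _ => replace q with (L + D) in Hq
    by (unfold L, D; field; exact Hh0) end.
  replace (x + INR n - 2) with (x - 2 + INR n) in Hq by ring.
  replace (x + INR n + 1) with (x + 1 + INR n) in Hq by ring.
  unfold pole_sum in H1.
  apply Rabs_def2 in H1. apply Rabs_def2 in H2. apply Rabs_def2 in H3. apply Rabs_def2 in Hd.
  apply Rabs_def1; lra.
Qed.

(** Near x, Gamma is the exponential of ln Gamma, so its differentiability also comes from convexity
    and no differentiation under the integral sign occurs. *)
Lemma is_derive_RGamma (x : R) : 0 < x -> is_derive RGamma x (RGamma x * psi x).
Proof.
  intros Hx. destruct (RGamma_spec x Hx) as [_ Gx].
  apply (is_derive_ext_loc (fun y => exp (ln (RGamma y)))).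
  - exists (mkposreal x Hx). intros y Hy. change (Rabs (y - x) < x) in Hy.
    apply Rabs_def2 in Hy. apply exp_ln, RGamma_spec. lra.
  - evar_last.
    + apply (is_derive_comp exp (fun y => ln (RGamma y))); [apply is_derive_exp|].
      apply is_derive_ln_RGamma, Hx.
    + simpl. rewrite exp_ln by exact Gx. unfold scal; simpl. unfold mult; simpl. ring.
Qed.

(** * The digamma function on the real line *)

Lemma Cexp_RtoC (x : R) : Cexp (RtoC x) = RtoC (exp x).
Proof.
  unfold Cexp, RtoC, Re, Im. cbn [fst snd]. rewrite cos_0, sin_0.
  f_equal; ring.
Qed.

Lemma Rcpow_integrand (x t : R) :
  (Rcpow t (RtoC x - 1) * RtoC (exp (- t)))%C = RtoC (Gamma_integrand x t).
Proof.
  unfold Rcpow, Gamma_integrand.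
  replace ((RtoC x - 1) * RtoC (ln t))%C with (RtoC ((x - 1) * ln t))
    by (rewrite RtoC_mult, RtoC_minus; reflexivity).
  rewrite Cexp_RtoC, <- RtoC_mult. reflexivity.
Qed.

Lemma is_RInt_0_oo_RtoC (f : R -> R) (l : R) :
  is_RInt_0_oo f l ->
  is_RInt_gen (V := C_R_CompleteNormedModule) (fun t => RtoC (f t))
    (at_right 0) (Rbar_locally p_infty) (RtoC l).
Proof.
  intros Hf P [eps HP].
  assert (HQ : locally l (fun u => P (RtoC u))).
  { exists eps. intros u Hu. apply HP. split; [exact Hu | apply ball_center]. }
  specialize (Hf _ HQ). unfold filtermapi in *.
  revert Hf. apply filter_imp. intros [a b] [y [Hy Py]].
  exists (RtoC y). split; [|exact Py].
  apply (is_RInt_fct_extend_pair (U := R_NormedModule) (V := R_NormedModule)).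
  - exact Hy.
  - simpl. evar_last; [apply (is_RInt_const (V := R_NormedModule))|].
    unfold scal; simpl. unfold mult; simpl. ring.
Qed.

Lemma Euler_integral_RtoC (x : R) : 0 < x -> Euler_integral (RtoC x) = RtoC (RGamma x).
Proof.
  intros Hx. unfold Euler_integral.
  apply (is_RInt_gen_unique (V := C_R_CompleteNormedModule)
           (Fa := at_right 0) (Fb := Rbar_locally p_infty)).
  apply (is_RInt_gen_ext (V := C_R_CompleteNormedModule)
           (Fa := at_right 0) (Fb := Rbar_locally p_infty) (fun t => RtoC (Gamma_integrand x t))).
  - apply filter_forall. intros ab t _. symmetry. apply Rcpow_integrand.
  - apply is_RInt_0_oo_RtoC. apply RGamma_spec, Hx.
Qed.

Lemma rising_RtoC (x : R) (n : nat) : rising (RtoC x) n = RtoC (pole_poly n x).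
Proof.
  unfold pole_poly. induction n as [|n IH]; [reflexivity|].
  simpl. rewrite IH, RtoC_mult, RtoC_plus. reflexivity.
Qed.

Lemma pole_poly_neq_0 (n : nat) (x : R) :
  (forall k, (k < n)%nat -> x + INR k <> 0) -> pole_poly n x <> 0.
Proof.
  unfold pole_poly. induction n as [|n IH]; intros Hx; simpl; [lra|].
  apply Rmult_integral_contrapositive_currified; [|apply Hx; lia].
  apply IH. intros; apply Hx; lia.
Qed.

Lemma pole_poly_add (m n : nat) (x : R) :
  pole_poly (m + n) x = pole_poly m x * pole_poly n (x + INR m).
Proof.
  unfold pole_poly. induction n as [|n IH].
  - rewrite Nat.add_0_r. simpl. ring.
  - rewrite Nat.add_succ_r. simpl. rewrite IH, plus_INR. ring.
Qed.

Lemma RGamma_add (x : R) (n : nat) : 0 < x -> RGamma (x + INR n) = RGamma x * pole_poly n x.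
Proof.
  intros Hx. unfold pole_poly. induction n as [|n IH]; [simpl; rewrite Rplus_0_r; ring|].
  pose proof (pos_INR n).
  rewrite S_INR, <- Rplus_assoc, RGamma_succ, IH by lra. simpl. ring.
Qed.

Lemma shift_spec (x : R) : - x < INR (shift (RtoC x)) /\
  (shift (RtoC x) = O \/ INR (shift (RtoC x)) <= 1 - x).
Proof.
  unfold shift. simpl. destruct (archimed (- x)) as [H1 H2].
  destruct (Z.le_gt_cases 0 (up (- x))) as [H|H].
  - rewrite INR_IZR_INZ, Z2Nat.id by exact H. split; [|right]; lra.
  - replace (Z.to_nat (up (- x))) with O by lia. split; [|left; reflexivity].
    apply IZR_lt in H. simpl. lra.
Qed.

(** The formula of [Gamma] with the shift fixed to j, so that a single differentiable expression is
    available on the whole component. *)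
Definition RGamma_ext (j : nat) (x : R) : R := RGamma (x + INR j) / pole_poly j x.

(** It is enough to know that the shift chosen by [Gamma] is at most j: the functional equation
    absorbs the remaining factors. *)
Lemma Gamma_RtoC (j : nat) (x : R) :
  between_poles j x -> Gamma (RtoC x) = RtoC (RGamma_ext j x).
Proof.
  intros Hj. unfold Gamma, RGamma_ext.
  destruct (shift_spec x) as [H1 H2]. set (n := shift (RtoC x)) in *.
  assert (Hnz : forall m, pole_poly m x <> 0).
  { intros m. apply pole_poly_neq_0. intros k _. apply between_poles_neq with j, Hj. }
  assert (Hnj : (n <= j)%nat).
  { destruct H2 as [->|H2]; [lia|]. destruct Hj as [Hj _].
    assert (H : INR n < INR (S j)) by (rewrite S_INR; lra). apply INR_lt in H. lia. }
  rewrite rising_RtoC, <- RtoC_plus, Euler_integral_RtoC by lra.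
  rewrite <- RtoC_div by apply Hnz.
  f_equal. replace j with (n + (j - n))%nat by lia.
  rewrite pole_poly_add, plus_INR, <- Rplus_assoc, (RGamma_add (x + INR n)) by lra.
  field. split; [|apply Hnz].
  intros E. apply (Hnz j). replace j with (n + (j - n))%nat by lia.
  rewrite pole_poly_add, E. ring.
Qed.

Lemma RGamma_ext_neq_0 (j : nat) (x : R) : between_poles j x -> RGamma_ext j x <> 0.
Proof.
  intros Hj. unfold RGamma_ext, Rdiv. apply Rmult_integral_contrapositive_currified.
  - apply Rgt_not_eq, RGamma_spec. destruct Hj. lra.
  - apply Rinv_neq_0_compat, pole_poly_neq_0. intros k _. apply between_poles_neq with j, Hj.
Qed.

(** The logarithmic derivative of the quotient is psi(x + j) minus the sum of 1/(x + k) for k < j,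
    which is psi(x) by [psi_shift]. *)
Lemma is_derive_RGamma_ext (j : nat) (x : R) :
  between_poles j x -> is_derive (RGamma_ext j) x (RGamma_ext j x * psi x).
Proof.
  intros Hj.
  assert (Hnz : forall k, x + INR k <> 0) by (intros k; apply between_poles_neq with j, Hj).
  assert (HQ : is_derive (pole_poly j) x (pole_poly j x * psum (fun k => / (x + INR k)) j)).
  { generalize j. intros n. induction n as [|n IH].
    - evar_last; [apply (is_derive_const 1)|]. simpl. unfold zero; simpl. ring.
    - evar_last; [apply is_derive_pole_poly_S, IH|].
      unfold pole_poly. simpl. field. apply Hnz. }
  rewrite (psi_shift x j). unfold RGamma_ext.
  assert (Hq : pole_poly j x <> 0) by (apply pole_poly_neq_0; auto).
  evar_last.
  - apply (is_derive_div (fun y => RGamma (y + INR j)) (pole_poly j)); [|exact HQ | exact Hq].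
    apply (is_derive_comp RGamma (fun y => y + INR j)).
    + apply is_derive_RGamma. destruct Hj. lra.
    + auto_derive; [exact I | reflexivity].
  - unfold scal; simpl. unfold mult; simpl. unfold pole_sum. field. exact Hq.
Qed.

Lemma between_poles_locally (j : nat) (x : R) :
  between_poles j x -> locally x (between_poles j).
Proof.
  intros Hx. destruct (between_poles_open j x Hx) as [d [Hd [Hl Hr]]].
  exists (mkposreal d Hd). intros y Hy. change (Rabs (y - x) < d) in Hy.
  apply Rabs_def2 in Hy. apply between_poles_convex with (x - d) (x + d); auto; lra.
Qed.

(** [C_derive] moves along the horizontal line through the point, here the real axis, so only the
    real values of f near x enter the two component limits. *)
Lemma C_derive_RtoC (f : C -> C) (g : R -> R) (x d : R) :
  locally x (fun y => f (RtoC y) = RtoC (g y)) -> is_derive g x d ->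
  C_derive f (RtoC x) = RtoC d.
Proof.
  intros Hfg Hg.
  assert (Hx : f (RtoC x) = RtoC (g x)) by (apply (locally_singleton _ _ Hfg)).
  assert (Hq : locally' x (fun y => ((f (y, 0%R) - f (x, 0%R)) / ((y, 0%R) - (x, 0%R)))%C
                 = RtoC ((g y - g x) / (y - x)))).
  { unfold locally', within. revert Hfg. apply filter_imp. intros y Hy Hyx.
    change (y, 0) with (RtoC y). change (x, 0) with (RtoC x).
    rewrite Hy, Hx, <- !RtoC_minus, <- RtoC_div by lra. reflexivity. }
  unfold C_derive, C_lim. change (RtoC x) with (x, 0). cbn [fst snd].
  apply injective_projections; cbn [fst snd RtoC].
  - rewrite (is_lim_unique _ x d); [reflexivity|].
    apply (is_lim_ext_loc (fun y => (g y - g x) / (y - x))).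
    + revert Hq. apply filter_imp. intros y Hy. exact (eq_sym (f_equal fst Hy)).
    + apply is_derive_Reals in Hg. apply is_lim_spec. intros eps.
      destruct (Hg eps (cond_pos eps)) as [del Hdel].
      exists del. intros y Hy Hyx. change (Rabs (y - x) < del) in Hy.
      specialize (Hdel (y - x) ltac:(lra) Hy).
      rewrite Rplus_minus in Hdel. exact Hdel.
  - rewrite (is_lim_unique _ x 0); [reflexivity|].
    apply (is_lim_ext_loc (fun y => 0)); [|apply is_lim_const].
    revert Hq. apply filter_imp. intros y Hy. exact (eq_sym (f_equal snd Hy)).
Qed.

Lemma digamma_RtoC (j : nat) (x : R) : between_poles j x -> digamma (RtoC x) = RtoC (psi x).
Proof.
  intros Hj. unfold digamma.
  rewrite (C_derive_RtoC Gamma (RGamma_ext j) x (RGamma_ext j x * psi x)).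
  - rewrite (Gamma_RtoC j x Hj), <- RtoC_div by (apply RGamma_ext_neq_0, Hj).
    f_equal. field. apply RGamma_ext_neq_0, Hj.
  - generalize (between_poles_locally j x Hj). apply filter_imp.
    intros y Hy. apply Gamma_RtoC, Hy.
  - apply is_derive_RGamma_ext, Hj.
Qed.

Lemma digamma_zero_RtoC (x : R) :
  digamma_zero (RtoC x) <-> exists j, between_poles j x /\ psi x = 0.
Proof.
  split.
  - intros [Hdom Hz]. exists (shift (RtoC x)).
    assert (Hj : between_poles (shift (RtoC x)) x).
    { destruct (shift_spec x) as [H1 H2]. split; [lra|].
      destruct H2 as [H2|[H2|H2]]; [left; exact H2 | right; lra |].
      (* The equality [shift] = 1 - x occurs when x is an integer; a shift n + 1 then means x = -n,
         which the domain excludes. *)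
      destruct (shift (RtoC x)) as [|n] eqn:E; [left; reflexivity|].
      exfalso. apply (Hdom n). f_equal. rewrite S_INR in H2. lra. }
    split; [exact Hj|]. rewrite (digamma_RtoC _ _ Hj) in Hz. apply RtoC_inj, Hz.
  - intros [j [Hj Hz]]. split.
    + intros n E. apply RtoC_inj in E. apply (between_poles_neq j n x Hj). lra.
    + rewrite (digamma_RtoC _ _ Hj), Hz. reflexivity.
Qed.

(** * Matching the enumeration with the components *)

Lemma psi_zero_unique (j : nat) (x y : R) :
  between_poles j x -> between_poles j y -> psi x = 0 -> psi y = 0 -> x = y.
Proof.
  intros Hx Hy Fx Fy. destruct (Rtotal_order x y) as [H|[H|H]]; [|exact H|].
  - pose proof (psi_increasing j x y Hx Hy H). lra.
  - pose proof (psi_increasing j y x Hy Hx H). lra.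
Qed.

Lemma decreasing_lt (u : nat -> R) :
  (forall k, u (S k) < u k) -> forall i j, (i < j)%nat -> u j < u i.
Proof.
  intros Hu i j Hij. induction Hij as [|j Hij IH]; [apply Hu|].
  specialize (Hu j). lra.
Qed.

(** Strong induction on k. If a_k lay in a component j < k, it would coincide with a_j by
    uniqueness. If j > k, the zero b of component k would exceed a_k; being listed, b = a_m, where m
    < k puts it in another component by induction and m >= k contradicts the decreasing order. *)
Lemma psi_zeros_enumeration (a : nat -> R) :
  (forall k, a (S k) < a k) ->
  (forall x, (exists j, between_poles j x /\ psi x = 0) <-> exists k, x = a k) ->
  forall k, between_poles k (a k) /\ psi (a k) = 0.
Proof.
  intros Hdec Hz k. induction k as [k IH] using (well_founded_induction lt_wf).
  destruct (proj2 (Hz (a k)) (ex_intro _ k eq_refl)) as [j [Hj Fj]].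
  destruct (Nat.lt_trichotomy j k) as [Hjk|[->|Hjk]]; [|split; assumption|].
  - exfalso. destruct (IH j Hjk) as [Bj Pj].
    pose proof (psi_zero_unique j _ _ Hj Bj Fj Pj).
    pose proof (decreasing_lt a Hdec j k Hjk). lra.
  - exfalso. destruct (psi_zero k) as [b [Bk Fk]].
    pose proof (between_poles_distinct k j b (a k) Hjk Bk Hj) as Hlt.
    destruct (proj1 (Hz b)) as [m Hm]; [exists k; auto|]. subst b.
    destruct (Nat.lt_trichotomy m k) as [Hmk|[->|Hmk]].
    + pose proof (between_poles_distinct m k (a m) (a m) Hmk (proj1 (IH m Hmk)) Bk). lra.
    + lra.
    + pose proof (decreasing_lt a Hdec k m Hmk). lra.
Qed.

Theorem mainTheorem4
  (alpha : nat -> R)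
  (alpha_decreasing : forall k : nat, alpha (S k) < alpha k)
  (alpha_zeros : forall z : C,
     digamma_zero z <-> exists k : nat, z = RtoC (alpha k)) :
  is_series (fun k : nat => 1 / (alpha k ^ 2 - 1))
    (Euler_gamma / 2 + PI ^ 2 / (12 * Euler_gamma) - 1).
Proof.
  assert (H : forall k, between_poles k (alpha k) /\ psi (alpha k) = 0).
  { apply psi_zeros_enumeration; [exact alpha_decreasing|].
    intros x. rewrite <- digamma_zero_RtoC, alpha_zeros.
    split; intros [k Hk]; exists k; [apply RtoC_inj, Hk | rewrite Hk; reflexivity]. }
  apply series_over_psi_zeros; intros k; apply H.
Qed.
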